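(* Let $\mathscr E\to M$ be a Riemannian vector bundle over a Riemannian manifold $(M,g)$ of dimension $m$, equipped with the Sasaki metric, and suppose $\sigma$ is a smooth section of $\mathscr E$ with constant length. For $r\in\{1,\dots,m\}$, $\sigma$ is an $r$-harmonic section of $\mathscr E$ if and only if $\sigma$ is $r$-parallel. In particular, $\sigma$ is an $r$-harmonic section of $\mathscr E$ for all $r\geq\operatorname{rank}\mathscr E$ (with $r\le m$).
   Context: A Riemannian vector bundle is a vector bundle $\mathscr E\to M$ with a linear connection $\nabla$ and a holonomy-invariant (i.e. $\nabla$-parallel) fibre metric $\langle\cdot,\cdot\rangle$. With the Sasaki metric $k(A,B)=g(d\pi(A),d\pi(B))+\langle\kappa(A),\kappa(B)\rangle$ ($\kappa$ the connection map of $\nabla$), the vertical derivative of a section $\sigma$ corresponds to $\nabla\sigma$. Accordingly, let $\alpha$ be the $(1,1)$-tensor on $M$ with $g(\alpha(X),Y)=\langle\nabla_X\sigma,\nabla_Y\sigma\rangle$, $\varepsilon^v_r(\sigma)$ the $r$-th elementary symmetric polynomial of its eigenvalues, and $\mathcal E^v_r(\sigma)=\frac12\int_M\varepsilon^v_r(\sigma)\,\mathrm{vol}(g)$ (if $M$ is not compact, the energy is taken over relatively compact domains and variations are supported in them). The section $\sigma$ is an $r$-harmonic section of $\mathscr E$ if it is a critical point of $\mathcal E^v_r$ with respect to variations through sections of $\mathscr E$. The section $\sigma$ is $r$-parallel if the rank of $\nabla\sigma\colon T_xM\to\mathscr E_x$ is strictly less than $r$ at every $x\in M$. *)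

(* Defs.v *)
(* MathComp-Analysis development: smooth manifolds, vector bundles with linear
   connection and parallel fibre metric, and the vertical r-energy of sections. *)
From mathcomp Require Export all_boot all_order all_algebra.
From mathcomp Require Export all_classical all_reals all_analysis.
Export Order.TTheory GRing.Theory Num.Theory.
Export numFieldNormedType.Exports.

Set Implicit Arguments.
Unset Strict Implicit.
Unset Printing Implicit Defensive.

Local Open Scope classical_set_scope.
Local Open Scope ring_scope.

(* Class C^k and C^oo on a set A, used only for open A: the derivatives below
   then depend on the values of f on A alone. *)
Fixpoint is_Ck (R : realType) (V W : normedModType R) (k : nat)
    (A : set V) (f : V -> W) : Prop :=
  match k with
  | 0 => forall x, A x -> {for x, continuous f}
  | k'.+1 => (forall x, A x -> differentiable f x) /\
             (forall v : V, is_Ck k' A ('D_v f))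
  end.

Definition smooth_on (R : realType) (V W : normedModType R)
    (A : set V) (f : V -> W) : Prop := forall k, is_Ck k A f.

(* A smooth structure is given by a countable smooth atlas, which every second
   countable manifold has; second countability is built in this way. Manifolds are
   nonempty, which is the only role of the base point of a [ptopologicalType].
   [chart i] and [chart_inv i] are only meaningful on [dom i] and on its image. *)
Record manifold (R : realType) (m : nat) := Manifold {
  points :> ptopologicalType;
  points_hausdorff : hausdorff_space points;
  dom : nat -> set points;
  chart : nat -> points -> 'rV[R]_m;
  chart_inv : nat -> 'rV[R]_m -> points;
  dom_open : forall i, open (dom i);
  dom_cover : forall x, exists i, dom i x;
  chartK : forall i x, dom i x -> chart_inv i (chart i x) = x;
  chart_open : forall i, open (chart i @` dom i);
  chart_continuous : forall i x, dom i x -> {for x, continuous (chart i)};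
  chart_inv_continuous : forall i x, dom i x ->
    {for chart i x, continuous (chart_inv i)};
  chart_smooth : forall i j,
    smooth_on (chart i @` (dom i `&` dom j)) (chart j \o chart_inv i) }.
Arguments dom {R m M} i _ : rename.
Arguments chart {R m M} i _ : rename.
Arguments chart_inv {R m M} i _ : rename.

Definition smoothM (R : realType) (m : nat) (M : manifold R m)
    (W : normedModType R) (A : set M) (f : M -> W) : Prop :=
  forall i, smooth_on (chart i @` (dom i `&` A)) (f \o chart_inv i).

Definition chart_at (R : realType) (m : nat) (M : manifold R m) (x : M) : nat :=
  projT1 (cid (dom_cover x)).

(* The tangent space at x is identified with R^m through the preferred chart
   [chart_at x]; every other chart reads tangent vectors through the Jacobian of
   the change of coordinates (see [tangent_coord] and [coord_vect]). *)
Definition tangent (R : realType) (m : nat) (M : manifold R m) (x : M) : Type :=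
  'rV[R]_m.

Definition tangent_coord (R : realType) (m : nat) (M : manifold R m)
    (i : nat) (x : M) (X : tangent x) : 'rV[R]_m :=
  'D_(X : 'rV[R]_m) (chart (M := M) i \o chart_inv (chart_at x)) (chart (chart_at x) x).

(* the coordinate vector d/dx^a of the chart i, at x *)
Definition coord_vect (R : realType) (m : nat) (M : manifold R m)
    (i : nat) (a : 'I_m) (x : M) : tangent x :=
  'D_(delta_mx 0 a : 'rV[R]_m) (chart (M := M) (chart_at x) \o chart_inv i) (chart i x).

(* the derivative X f of a function f along a tangent vector X at x *)
Definition dfun (R : realType) (m : nat) (M : manifold R m)
    (f : M -> R) (x : M) (X : tangent x) : R :=
  'D_(X : 'rV[R]_m) (f \o chart_inv (chart_at x)) (chart (chart_at x) x).

Definition smooth_vector_field (R : realType) (m : nat) (M : manifold R m)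
    (X : forall x : M, tangent x) : Prop :=
  forall i, smoothM (dom i) (fun x => tangent_coord i (X x)).

Definition inner_product (R : realType) (V : lmodType R) (b : V -> V -> R) : Prop :=
  [/\ forall (a : R) u v w, b (a *: u + v) w = a * b u w + b v w,
      forall u v, b u v = b v u
    & forall u, u != 0 -> 0 < b u u].

Record riemannian_metric (R : realType) (m : nat) (M : manifold R m) :=
  RiemannianMetric {
  metric :> forall x : M, tangent x -> tangent x -> R;
  metric_inner : forall x, inner_product (metric (x := x));
  metric_smooth : forall i a b,
    smoothM (dom i) (fun x => metric (coord_vect i a x) (coord_vect i b x)) }.

(* A vector bundle of rank n: its total space is the disjoint union of the
   fibres, with the topology and smooth structure for which the local
   trivialisations [triv j] over the open sets [tdom j] are diffeomorphisms. *)
Record vector_bundle (R : realType) (m : nat) (M : manifold R m) (n : nat) :=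
  VectorBundle {
  fibre :> M -> vectType R;
  tindex : Type;
  tdom : tindex -> set M;
  triv : tindex -> forall x, 'Hom(fibre x, 'rV[R]_n);
  triv_inv : tindex -> forall x, 'Hom('rV[R]_n, fibre x);
  tdom_open : forall j, open (tdom j);
  tdom_cover : forall x, exists j, tdom j x;
  trivK : forall j x, tdom j x -> cancel (triv j x) (triv_inv j x);
  triv_invK : forall j x, tdom j x -> cancel (triv_inv j x) (triv j x);
  triv_smooth : forall j k (u : 'rV[R]_n),
    smoothM (tdom j `&` tdom k) (fun x => triv k x (triv_inv j x u)) }.
Arguments tdom {R m M n E} j _ : rename.
Arguments triv {R m M n E} j x : rename.
Arguments triv_inv {R m M n E} j x : rename.

Definition smooth_section (R : realType) (m : nat) (M : manifold R m) (n : nat)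
    (E : vector_bundle M n) (s : forall x, E x) : Prop :=
  forall j, smoothM (tdom j) (fun x => triv j x (s x)).

(* Covariant derivatives: [conn s x X] is nabla_X s at x. The operator is total,
   and only its values on smooth sections are meaningful. *)
Record linear_connection (R : realType) (m : nat) (M : manifold R m) (n : nat)
    (E : vector_bundle M n) := LinearConnection {
  conn :> (forall x, E x) -> forall x, 'Hom(tangent x, E x);
  conn_smooth : forall (s : forall x, E x) (X : forall x : M, tangent x),
    smooth_section s -> smooth_vector_field X ->
    smooth_section (fun x => conn s x (X x));
  connD : forall s t : forall x, E x, smooth_section s -> smooth_section t ->
    forall x, conn (fun y => s y + t y) x = conn s x + conn t x;
  conn_leibniz : forall (f : M -> R) (s : forall x, E x),
    smoothM setT f -> smooth_section s ->
    forall x (X : tangent x),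
      conn (fun y => f y *: s y) x X = dfun f X *: s x + f x *: conn s x X }.

Record fibre_metric (R : realType) (m : nat) (M : manifold R m) (n : nat)
    (E : vector_bundle M n) := FibreMetric {
  fmetric :> forall x : M, E x -> E x -> R;
  fmetric_inner : forall x, inner_product (fmetric (x := x));
  fmetric_smooth : forall j (u v : 'rV[R]_n),
    smoothM (tdom j) (fun x => fmetric (triv_inv j x u) (triv_inv j x v)) }.

Record riemannian_vector_bundle (R : realType) (m : nat) (M : manifold R m)
    (n : nat) := RiemannianVectorBundle {
  bundle :> vector_bundle M n;
  nabla : linear_connection bundle;
  fib : fibre_metric bundle;
  fib_parallel : forall s t : forall x, bundle x,
    smooth_section s -> smooth_section t ->
    forall x (X : tangent x),
      dfun (fun y => fib y (s y) (t y)) X =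
      fib x (nabla s x X) (t x) + fib x (s x) (nabla t x X) }.

(* Integral over R^m by iterated one-dimensional Lebesgue integrals; by Tonelli
   this is the Lebesgue integral of a nonnegative Borel function. *)
Fixpoint integral_rV (R : realType) (m : nat) : ('rV[R]_m -> \bar R) -> \bar R :=
  match m return ('rV[R]_m -> \bar R) -> \bar R with
  | 0 => fun f => f 0
  | m'.+1 => fun f =>
      (\int[@lebesgue_measure R]_(x in [set: R])
         integral_rV (fun y : 'rV[R]_m' => f (row_mx (x%:M : 'rV[R]_1) y)))%E
  end.

Notation borel T := (g_sigma_algebraType (@open T)).

Definition gram (R : realType) (m : nat) (M : manifold R m)
    (g : riemannian_metric M) (i : nat) (x : M) : 'M[R]_m :=
  \matrix_(a, b) g x (coord_vect i a x) (coord_vect i b x).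

(* vol(g) is the Borel measure on M which in every chart has the density
   sqrt(det g_ab) with respect to Lebesgue measure; as countably many charts
   cover M, this property determines it. *)
Record riemannian_volume (R : realType) (m : nat) (M : manifold R m)
    (g : riemannian_metric M) := RiemannianVolume {
  vol :> {measure set (borel M) -> \bar R};
  volE : forall i (B : set (borel M)), measurable B -> B `<=` dom i ->
    vol B = integral_rV (fun y =>
      (\1_(chart i @` B) y * Num.sqrt (\det (gram g i (chart_inv i y))))%:E) }.

Section VerticalEnergy.
Context (R : realType) (m : nat) (M : manifold R m) (g : riemannian_metric M)
  (mu : riemannian_volume g) (n : nat) (E : riemannian_vector_bundle M n).
Implicit Types (s : forall x, E x) (x : M) (r : nat) (D : set M).

(* the endomorphism of T_x M with g (alpha X) Y = <nabla_X s, nabla_Y s>; it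
   exists and is unique since g is an inner product *)
Definition alpha s x : 'End(tangent x) :=
  xget 0 [set A : 'End(tangent x) | forall X Y : tangent x,
    g x (A X) Y = fib E x (nabla E s x X) (nabla E s x Y)].

(* the eigenvalues of alpha, counted with multiplicity: alpha is self-adjoint,
   hence its characteristic polynomial splits over the reals *)
Definition eigenvalues s x : m.-tuple R :=
  xget [tuple 0 | _ < m] [set l : m.-tuple R |
    char_poly (lin1_mx (alpha s x : 'rV[R]_m -> 'rV[R]_m)) =
    \prod_(c <- l) ('X - c%:P)].

Definition elem_sym (l : m.-tuple R) r : R :=
  \sum_(A : {set 'I_m} | #|A| == r) \prod_(i in A) tnth l i.

Definition vertical_energy r s D : R :=
  2^-1 * (\int[mu]_(x in (D : set (borel M))) elem_sym (eigenvalues s x) r)%R.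

(* smooth variations of s, defined for |t| < delta and supported in a compact
   subset K of D *)
Definition variation s D (S : R -> forall x, E x) : Prop :=
  exists delta : R, [/\ 0 < delta,
    forall i j, smooth_on
      [set p : R * 'rV[R]_m |
        `|p.1| < delta /\ (chart i @` (dom i `&` tdom j)) p.2]
      (fun p => triv j (chart_inv i p.2) (S p.1 (chart_inv i p.2))),
    forall x, S 0 x = s x
  & exists K : set M, [/\ compact K, K `<=` D &
      forall t x, `|t| < delta -> ~ K x -> S t x = s x]].

(* If M is compact, D = M is allowed, and the condition for D = M implies the
   one for every other D. *)
Definition r_harmonic r s : Prop :=
  forall D, open D -> compact (closure D) ->
  forall S, variation s D S ->
    is_derive (0 : R) (1 : R) (fun t : R => vertical_energy r (S t) D) 0.

Definition r_parallel r s : Prop :=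
  forall x, (\dim (limg (nabla E s x)) < r)%N.

Definition constant_length s : Prop :=
  exists c : R, forall x, Num.sqrt (fib E x (s x) (s x)) = c.

End VerticalEnergy.

(* Main.v *)
Require Import Defs.
From HB Require Import structures.
From mathcomp Require Import perm measurable_realfun ring lra.
From mathcomp Require complex.

Set Implicit Arguments.
Unset Strict Implicit.
Unset Printing Implicit Defensive.

Local Open Scope ring_scope.

(* Scaling a section s of constant length by 1 + t f changes <nabla s, nabla s> into
   (1 + t f)^2 <nabla s, nabla s> plus a rank one nonnegative term, because nabla s is
   orthogonal to s. Elementary symmetric functions of the eigenvalues are monotone under
   such perturbations, so for f >= 0 the r-energy grows at least linearly in t wherever
   eps_r(s) > 0, which is impossible for a critical point; and eps_r(s) = 0 means that
   nabla s has rank < r. Conversely eps_r is a sum of squares of r-minors of nabla s; if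
   these vanish for s they are O(t) along any variation, uniformly on compact sets, so the
   energy is O(t^2). Finally the image of nabla s lies in the orthogonal complement of s,
   hence its rank is smaller than the rank of the bundle (or s = 0).

   Monotonicity, positivity and vanishing of eps_r all follow from the Cauchy-Binet formula,
   after writing the metrics on the base and on the fibres as P P^T and Q Q^T. *)

(** * Sums of principal minors *)

(** No first variation formula is derived and no integral is differentiated: both implications rest
    on inequalities, a linear lower bound for t >= 0 against criticality and a quadratic upper bound
    in favour of it.

    The obstacle is that [eigenvalues] is a choice by [xget], without order or regularity. It enters
    only through the characteristic polynomial of [alpha]: in any chart and trivialisation this is
    the polynomial of [vertical_mx] times the inverse of [gram], whose coefficients are sums of
    principal minors up to sign. In frames orthonormal for both metrics that matrix becomes L L^T,
    with L representing nabla s.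

    The growth is linear because nabla ((1 + t f) s) is t df times s plus (1 + t f) nabla s. The
    part along s only adds to the energy, and eps_r scales by (1 + t f)^(2r) >= 1 + t f, as r >= 1
    and t f >= 0. *)

Section PrincipalMinors.
Context (F : comNzRingType).

(* The determinant of the submatrix of A with rows and columns in I, written as a
   determinant of full size to avoid reindexing. *)
Definition pminor (m : nat) (A : 'M[F]_m) (I : {set 'I_m}) : F :=
  \det (\matrix_(i, j) (if i \in I then A i j else (i == j)%:R)).

Definition sum_pminors (m : nat) (A : 'M[F]_m) (r : nat) : F :=
  \sum_(I : {set 'I_m} | #|I| == r) pminor A I.

(** Multilinearity in the rows: I collects the rows taken from P. *)
Lemma det_row_sum m (P Q : 'M[F]_m) :
  \det (P + Q) = \sum_(I : {set 'I_m}) \det (\matrix_(i, j) (if i \in I then P i j else Q i j)).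
Proof.
rewrite /determinant [RHS]exchange_big; apply: eq_bigr => s _ /=.
rewrite -mulr_sumr; congr (_ * _).
rewrite (eq_bigr (fun i => P i (s i) + Q i (s i))); last by move=> i _; rewrite mxE.
rewrite bigA_distr; apply: eq_bigr => I _.
by apply: eq_bigr => i _; rewrite mxE.
Qed.

Lemma det_row_scale m (d : 'I_m -> F) (A : 'M[F]_m) :
  \det (\matrix_(i, j) (d i * A i j)) = (\prod_i d i) * \det A.
Proof.
rewrite /determinant mulr_sumr; apply: eq_bigr => s _.
rewrite mulrCA; congr (_ * _); rewrite -big_split /=.
by apply: eq_bigr => i _; rewrite mxE.
Qed.

Lemma prod_in_const m (I : {set 'I_m}) (c d : F) :
  \prod_i (if i \in I then c else d) = c ^+ #|I| * d ^+ (m - #|I|).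
Proof.
rewrite (bigID (mem I)) /=; congr (_ * _).
  rewrite (eq_bigr (fun=> c)); last by move=> i ->.
  by rewrite prodr_const.
rewrite (eq_bigr (fun=> d)); last by move=> i /negbTE ->.
rewrite prodr_const; congr (_ ^+ _).
have -> : (m - #|I|)%N = #|~: I| by rewrite [RHS]cardsCs finset.setCK card_ord.
by apply: eq_card => i; rewrite !inE.
Qed.

End PrincipalMinors.

Section Coef.
Context (F : comNzRingType).

(** Splitting the rows of X - A between the two summands, the subset I contributes (-1)^|I|
    X^(m-|I|) times the principal minor on I, so the coefficient of X^(m-r) sees exactly the I with
    r elements. *)
Lemma char_poly_coef m (A : 'M[F]_m) r : (r <= m)%N ->
  (char_poly A)`_(m - r) = (-1) ^+ r * sum_pminors A r.
Proof.
move=> rm; rewrite /char_poly.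
have -> : char_poly_mx A = map_mx polyC (- A) + 'X%:M.
  by apply/matrixP=> i j; rewrite !mxE rmorphN /= addrC.
rewrite det_row_sum coef_sum /sum_pminors mulr_sumr.
rewrite [RHS]big_mkcond /=; apply: eq_bigr => I _.
have -> : (\matrix_(i, j) (if i \in I then (map_mx polyC (- A)) i j else ('X%:M : 'M[{poly F}]_m) i j)) =
  \matrix_(i, j) ((if i \in I then (-1)%:P else 'X) *
    (map_mx polyC (\matrix_(i, j) (if i \in I then A i j else (i == j)%:R))) i j).
  apply/matrixP=> i j; rewrite !mxE; case: ifP => _.
    by rewrite -polyCM mulN1r.
  by rewrite polyC_natr mulr_natr.
rewrite det_row_scale prod_in_const det_map_mx -/(pminor A I).
rewrite -polyC_exp mulrAC -polyCM coefCM coefXn.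
have cI : (#|I| <= m)%N by rewrite -[leqRHS](card_ord m) max_card.
have -> : (m - r == m - #|I|)%N = (#|I| == r).
  apply/eqP/eqP => [|-> //] e; rewrite -(subKn cI) -e subKn //.
by case: eqP => [->|_]; rewrite ?mulr0 ?mulr1.
Qed.

Lemma sum_pminors_diag m (l : 'I_m -> F) r :
  sum_pminors (\matrix_(i, j) (l i *+ (i == j))) r =
  \sum_(I : {set 'I_m} | #|I| == r) \prod_(i in I) l i.
Proof.
apply: eq_bigr => I _; rewrite /pminor.
rewrite (_ : \matrix_(_, _) _ = diag_mx (\row_i (if i \in I then l i else 1))); last first.
  by apply/matrixP=> i j; rewrite !mxE; case: (i \in I).
rewrite det_diag [RHS]big_mkcond /=; apply: eq_bigr => i _.
by rewrite mxE.
Qed.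

(** The diagonal matrix with entries l has the same characteristic polynomial as A, hence the same
    coefficients, and its principal minors are products of the l i. *)
Lemma elem_sym_char_poly m (A : 'M[F]_m) (l : 'I_m -> F) r : (r <= m)%N ->
  char_poly A = \prod_i ('X - (l i)%:P) ->
  \sum_(I : {set 'I_m} | #|I| == r) \prod_(i in I) l i = sum_pminors A r.
Proof.
move=> rm cA; rewrite -sum_pminors_diag.
have e (B C : 'M[F]_m) : char_poly B = char_poly C -> @sum_pminors F m B r = sum_pminors C r.
  move=> eBC; have := char_poly_coef B rm; rewrite eBC (char_poly_coef C rm).
  move/(congr1 ( *%R ((-1) ^+ r))); rewrite !mulrA -expr2 sqrr_sign !mul1r.
  by move->.
apply: e; rewrite cA char_poly_trig; last first.
  apply/is_trig_mxP => i j ij; rewrite !mxE.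
  by case: eqP ij => // ->; rewrite ltnn.
by apply: eq_bigr => i _; rewrite mxE eqxx.
Qed.

Lemma sum_pminorsZ m (A : 'M[F]_m) (c : F) r :
  sum_pminors (c *: A) r = c ^+ r * sum_pminors A r.
Proof.
rewrite /sum_pminors mulr_sumr; apply: eq_bigr => I /eqP cI.
rewrite /pminor.
rewrite (_ : \matrix_(_, _) _ = \matrix_(i, j) ((if i \in I then c else 1) *
    (\matrix_(i, j) (if i \in I then A i j else (i == j)%:R)) i j)).
  by rewrite det_row_scale prod_in_const cI expr1n mulr1.
by apply/matrixP=> i j; rewrite !mxE; case: (i \in I); rewrite ?mul1r.
Qed.

(* For a permutation contributing to the Leibniz formula of the left-hand side,
   the indices outside I are fixed, so I is preserved. *)
Lemma pminor_sym m (A : 'M[F]_m) (I : {set 'I_m}) :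
  pminor A I = \det (\matrix_(i, j) (if (i \in I) && (j \in I) then A i j
                                    else ((i == j) && (i \notin I))%:R)).
Proof.
rewrite /pminor /determinant; apply: eq_bigr => s _; congr (_ * _).
have [/existsP[i /andP[iI si]]|/existsPn fixs] :=
    boolP [exists i, (i \notin I) && (s i != i)].
  rewrite (bigD1 i) //= [RHS](bigD1 i) //= !mxE.
  by rewrite (negbTE iI) /= eq_sym (negbTE si) !mul0r.
apply: eq_bigr => i _; rewrite !mxE.
have [iI|iI] := boolP (i \in I); rewrite ?andbT ?andbF //=.
case: ifPn => // siI; have := fixs (s i); rewrite siI /= negbK => /eqP /perm_inj e.
by rewrite e iI in siI.
Qed.

End Coef.

(** * The Cauchy-Binet formula *)

Section CauchyBinet.
Context (F : comNzRingType).

Lemma det_mulmx_expand m N (A : 'M[F]_(m, N)) (B : 'M[F]_(N, m)) :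
  \det (A *m B) = \sum_(h : {ffun 'I_m -> 'I_N})
     (\prod_i A i (h i)) * \det (\matrix_(i, j) B (h i) j).
Proof.
rewrite /determinant.
transitivity (\sum_(s : 'S_m) \sum_(h : {ffun 'I_m -> 'I_N})
   (-1) ^+ s * \prod_i (A i (h i) * B (h i) (s i))).
  apply: eq_bigr => s _; rewrite -mulr_sumr; congr (_ * _).
  rewrite -(bigA_distr_bigA (fun i k => A i k * B k (s i))) /=.
  by apply: eq_bigr => i _; rewrite mxE.
rewrite exchange_big; apply: eq_bigr => h _ /=.
rewrite mulr_sumr; apply: eq_bigr => s _.
rewrite big_split mulrCA; congr (_ * (_ * _)).
by apply: eq_bigr => i _; rewrite mxE.
Qed.

(* Summing over all maps h instead of the increasing ones only produces the factor m!. *)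
Lemma cauchy_binet m N (A : 'M[F]_(m, N)) (B : 'M[F]_(N, m)) :
  (m`!)%:R * \det (A *m B) = \sum_(h : {ffun 'I_m -> 'I_N})
     \det (\matrix_(i, j) A i (h j)) * \det (\matrix_(i, j) B (h i) j).
Proof.
transitivity (\sum_(s : 'S_m) \det (A *m B)).
  by rewrite sumr_const card_Sn mulr_natl.
transitivity (\sum_(s : 'S_m) \sum_(h : {ffun 'I_m -> 'I_N})
     ((-1) ^+ s * \prod_i A i (h (s i))) * \det (\matrix_(i, j) B (h i) j)).
  apply: eq_bigr => s _; rewrite det_mulmx_expand.
  (* In the copy of the determinant indexed by s, the map h is replaced by h o s; the sign from
     permuting the rows of B turns the sum over s into the minor of A. *)
  pose f (h : {ffun 'I_m -> 'I_N}) := [ffun i => h (s i)].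
  have fI : injective f.
    by move=> h k /ffunP e; apply/ffunP => i; have := e (s^-1%g i); rewrite !ffunE permKV.
  rewrite (reindex_inj fI); apply: eq_bigr => h _ /=.
  rewrite [X in X * _ = _](eq_bigr (fun i => A i (h (s i)))); last by move=> i _; rewrite ffunE.
  rewrite mulrAC mulrC; congr (_ * _).
  rewrite (_ : \matrix_(_, _) _ = row_perm s (\matrix_(i, j) B (h i) j)); last first.
    by apply/matrixP => i j; rewrite !mxE ffunE.
  by rewrite row_permE det_mulmx det_perm.
rewrite exchange_big; apply: eq_bigr => h _ /=.
rewrite -mulr_suml; congr (_ * _); apply: eq_bigr => s _; congr (_ * _).
by apply: eq_bigr => i _; rewrite mxE.
Qed.

Lemma cauchy_binet_gram m N (K : 'M[F]_(m, N)) :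
  (m`!)%:R * \det (K *m K^T) = \sum_(h : {ffun 'I_m -> 'I_N})
     (\det (\matrix_(i, j) K i (h j))) ^+ 2.
Proof.
rewrite cauchy_binet; apply: eq_bigr => h _.
rewrite expr2; congr (_ * _); rewrite -det_tr; congr (\det _).
by apply/matrixP => i j; rewrite !mxE.
Qed.

End CauchyBinet.

(** * Gram matrices over an ordered field *)

Section RealGram.
Context (R : realFieldType).

Lemma gram_det_ge0 m N (K : 'M[R]_(m, N)) : 0 <= \det (K *m K^T).
Proof.
rewrite -(pmulr_rge0 _ (x := (m`!)%:R)) ?ltr0n ?fact_gt0 // cauchy_binet_gram.
by apply: sumr_ge0 => h _; apply: sqr_ge0.
Qed.

(** K K^T + w w^T is the Gram matrix of the block row [K w]. By Cauchy-Binet its determinant is, up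
    to m!, a sum of squared minors over column choices, and the choices of columns of K alone
    already give the left-hand side. *)
Lemma gram_det_mono m N p (K : 'M[R]_(m, N)) (w : 'M[R]_(m, p)) :
  \det (K *m K^T) <= \det (K *m K^T + w *m w^T).
Proof.
rewrite -mul_row_col -tr_row_mx.
rewrite -(ler_pM2l (x := (m`!)%:R)) ?ltr0n ?fact_gt0 // !cauchy_binet_gram.
pose f (h : {ffun 'I_m -> 'I_N}) : {ffun 'I_m -> 'I_(N + p)} := [ffun i => lshift p (h i)].
have fI : injective f.
  by move=> h k /ffunP e; apply/ffunP => i; have := e i; rewrite !ffunE => /lshift_inj.
rewrite [leRHS](bigID (mem (codom f))) /= -[leLHS]addr0 lerD //; last first.
  by apply: sumr_ge0 => h _; apply: sqr_ge0.
rewrite -big_uniq /=; last by rewrite map_inj_uniq ?enum_uniq.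
rewrite big_image /=.
rewrite le_eqVlt; apply/orP; left; apply/eqP; apply: eq_bigr => h _.
by congr (\det _ ^+ 2); apply/matrixP => i j; rewrite [LHS]mxE [RHS]mxE ffunE row_mxEl.
Qed.

(** The extra m columns hold unit vectors for the rows outside I, so that a principal minor of a
    Gram matrix is again a full Gram determinant. *)
Definition pminor_root m n (L : 'M[R]_(m, n)) (I : {set 'I_m}) : 'M[R]_(m, n + m) :=
  row_mx (\matrix_(i, j) (if i \in I then L i j else 0))
         (\matrix_(i, j) ((i == j) && (i \notin I))%:R).

Lemma pminor_gram m n (L : 'M[R]_(m, n)) I :
  pminor (L *m L^T) I = \det (pminor_root L I *m (pminor_root L I)^T).
Proof.
rewrite pminor_sym /pminor_root tr_row_mx mul_row_col; congr (\det _).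
apply/matrixP => i j; rewrite !mxE.
under [X in _ = X + _]eq_bigr do rewrite !mxE.
under [X in _ = _ + X]eq_bigr do rewrite !mxE.
rewrite [X in _ = _ + X](bigD1 i) //= [X in _ = _ + (_ + X)]big1 ?addr0; last first.
  by move=> k; rewrite eq_sym => /negbTE ->; rewrite mul0r.
rewrite eqxx /=.
have [iI|iI] := boolP (i \in I); have [jI|jI] := boolP (j \in I) => //=.
- by rewrite mul0r addr0; apply: eq_bigr => k _; rewrite !mxE.
- by rewrite andbF mul0r addr0 big1 // => k _; rewrite mulr0.
- by rewrite andbF !andbT mulr0 addr0 big1 //; [case: eqP iI jI => // -> /negbTE -> |move=> k _; rewrite mul0r].
- rewrite !andbT mul1r big1 ?add0r ?[j == i]eq_sym // => k _; exact: mul0r.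
Qed.

Lemma sum_pminors_gram_ge0 m n (L : 'M[R]_(m, n)) r : 0 <= sum_pminors (L *m L^T) r.
Proof. by apply: sumr_ge0 => I _; rewrite pminor_gram gram_det_ge0. Qed.

(** Appending w to L appends to [pminor_root] columns that are zero outside I, so each principal
    minor grows by [gram_det_mono]; the order of the column blocks does not affect the Gram
    matrix. *)
Lemma sum_pminors_gram_mono m n p (L : 'M[R]_(m, n)) (w : 'M[R]_(m, p)) r :
  sum_pminors (L *m L^T) r <= sum_pminors (L *m L^T + w *m w^T) r.
Proof.
apply: ler_sum => I _.
rewrite -mul_row_col -tr_row_mx !pminor_gram.
set K := pminor_root L I; pose w' := \matrix_(i, j) (if i \in I then w i j else 0).
apply: le_trans (gram_det_mono K w') _.
rewrite le_eqVlt; apply/orP; left; apply/eqP; congr (\det _).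
rewrite /K /pminor_root !tr_row_mx !mul_row_col -addrA [X in _ + X]addrC addrA; congr (_ + _).
rewrite -!mul_row_col -!tr_row_mx.
have -> : row_mx (\matrix_(i, j) (if i \in I then L i j else 0)) w' =
  \matrix_(i, j) (if i \in I then row_mx L w i j else 0) => //.
apply/matrixP => i j; rewrite !mxE; case: fintype.split => k; rewrite !mxE //.
Qed.


Lemma mulmx_tr_eq0 m N (K : 'M[R]_(m, N)) : K *m K^T = 0 -> K = 0.
Proof.
move=> K0; apply/matrixP => i j; rewrite mxE; apply/eqP.
have := congr1 (fun M : 'M[R]_m => M i i) K0; rewrite !mxE => /eqP.
rewrite psumr_eq0 => [/allP /(_ j)|k _]; last by rewrite mxE -expr2 sqr_ge0.
by rewrite mem_index_enum mxE mulf_eq0 orbb; apply.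
Qed.

Lemma rank_diag_indicator m (I : {set 'I_m}) :
  (\rank (\matrix_(i, j) ((i == j) && (i \notin I))%:R : 'M[R]_m) <= m - #|I|)%N.
Proof.
have -> : (\matrix_(i, j) ((i == j) && (i \notin I))%:R : 'M[R]_m) =
    \sum_(k in ~: I) delta_mx k k.
  apply/matrixP => i j; rewrite mxE summxE.
  have [iI|iI] := boolP (i \in I).
    rewrite andbF big1 // => k; rewrite inE mxE => kI.
    by case: eqP => //= e; rewrite e (negbTE kI) in iI.
  rewrite (bigD1 i) ?inE //= mxE eqxx /= andbT eq_sym big1 ?addr0 //.
  by move=> k /andP[_ ki]; rewrite mxE [i == k]eq_sym (negbTE ki).
have -> : (m - #|I|)%N = #|~: I| by rewrite [RHS]cardsCs finset.setCK card_ord.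
rewrite -sum1_card; elim/big_ind2: _ => [|A a B b hA hB|k _]; first by rewrite mxrank0.
  by apply: leq_trans (mxrank_add _ _) _; rewrite leq_add.
by rewrite mxrank_delta.
Qed.

(** All terms are nonnegative, so the sum vanishes iff each minor does. If L has rank < r, the two
    blocks of [pminor_root L I] have ranks at most [\rank L] and m - r, too little for rank m.
    Otherwise, taking for I the indices of r independent rows gives a root with trivial left
    kernel. *)
Lemma sum_pminors_gram_eq0 m n (L : 'M[R]_(m, n)) r :
  (sum_pminors (L *m L^T) r == 0) = (\rank L < r)%N.
Proof.
rewrite /sum_pminors psumr_eq0; last by move=> I _; rewrite pminor_gram gram_det_ge0.
have [rL|rL] := ltnP.
  apply/allP => I _; apply/implyP => /eqP cI; rewrite pminor_gram.
  apply/contraT => dK.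
  have := mxrankM_maxl (pminor_root L I) (pminor_root L I)^T.
  rewrite mxrank_unit ?unitmxE ?unitfE // => mK.
  have cIm : (#|I| <= m)%N by rewrite -[leqRHS](card_ord m) max_card.
  suff : (m <= \rank L + (m - #|I|))%N.
    move=> h; have := leq_add h (leqnn #|I|).
    by rewrite -addnA subnK // addnC leq_add2r cI leqNgt rL.
  apply: leq_trans mK _; rewrite /pminor_root -mxrank_tr tr_row_mx -addsmxE.
  apply: leq_trans (mxrank_adds_leqif _ _) _; rewrite !mxrank_tr leq_add //.
    suff -> : \matrix_(i, j) (if i \in I then L i j else 0) =
      diag_mx (\row_i (i \in I)%:R) *m L by apply: mxrankM_maxr.
    apply/matrixP => i j; rewrite mxE mul_diag_mx !mxE.
    by case: ifP => _; rewrite ?mul1r ?mul0r.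
  exact: rank_diag_indicator.
apply/negbTE/allPn.
pose f (k : 'I_r) := maxrankfun L (widen_ord rL k).
have fI : injective f.
  by move=> a b /maxrankfun_inj /(congr1 val) /= /val_inj.
pose I : {set 'I_m} := [set f k | k in 'I_r].
exists I; first by rewrite mem_index_enum.
rewrite negb_imply card_imset // card_ord eqxx /= pminor_gram.
apply/negP => /eqP/eqP/det0P[v vn0].
move=> e; case/negP: vn0; apply/eqP.
have {e} vK : v *m pminor_root L I = 0.
  by apply: mulmx_tr_eq0; rewrite trmx_mul !mulmxA -[v *m _ *m _]mulmxA e mul0mx.
move: vK; rewrite mul_mx_row -row_mx0 => /eq_row_mx[vL vE].
have v0 i : i \notin I -> v 0 i = 0.
  move=> iI; have := congr1 (fun M : 'rV[R]_m => M 0 i) vE; rewrite !mxE.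
  rewrite (bigD1 i) //= mxE eqxx iI mulr1 big1 ?addr0 // => k.
  by rewrite mxE => /negbTE ->; rewrite mulr0.
(* As v vanishes outside I and I indexes rows of a maximal independent family, v L = 0 is a linear
   relation w between independent rows. *)
pose w : 'rV[R]_(\rank L) := \row_k v 0 (maxrankfun L k).
have w0 : w *m rowsub (maxrankfun L) L = 0.
  apply/matrixP => a j; rewrite !mxE.
  have := congr1 (fun M : 'rV[R]_n => M 0 j) vL; rewrite !mxE.
  under eq_bigr do rewrite mxE.
  rewrite (bigID (mem (codom (maxrankfun L)))) /= [X in _ + X]big1 ?addr0; last first.
    move=> i /negP iL; rewrite v0 ?mul0r //; apply/negP => /imsetP[k _ ik].
    by apply: iL; rewrite ik; apply: codom_f.
  rewrite -big_uniq /=; last by rewrite map_inj_uniq ?enum_uniq //; apply: maxrankfun_inj.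
  rewrite big_image /= => e; rewrite -[RHS]e; apply: eq_bigr => k _; rewrite !mxE.
  by case: ifPn => // /v0 ->; rewrite !mul0r.
have {}w0 : w = 0.
  by apply: (row_free_inj (maxrowsub_free L)); rewrite w0 mul0mx.
apply/matrixP => a i; rewrite ord1 mxE; have [/imsetP[k _ ->]|/v0 //] := boolP (i \in I).
by have := congr1 (fun M : 'rV[R]_(\rank L) => M 0 (widen_ord rL k)) w0; rewrite !mxE.
Qed.
End RealGram.

(** * Lipschitz bounds for products and determinants *)

Section Lipschitz.
Context (R : realFieldType).

Lemma prod_lipschitz (I : Type) (s : seq I) (b : R) : 0 <= b -> exists2 c, 0 <= c &
  forall (x y : I -> R) (t : R), `|t| <= 1 -> (forall i, `|x i| <= b) -> (forall i, `|y i| <= b) ->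
    `|\prod_(i <- s) (x i + t * y i) - \prod_(i <- s) x i| <= c * `|t|.
Proof.
move=> b0; elim: s => [|i s [c c0 IH]].
  by exists 0 => // x y t _ _ _; rewrite !big_nil subrr normr0 mul0r.
(* Telescoping in the first factor: b + b bounds |x i + t y i| because |t| <= 1, and [b ^+ size s]
   bounds the remaining product. *)
exists ((b + b) * c + b * b ^+ size s).
  by rewrite addr_ge0 ?mulr_ge0 ?addr_ge0 ?exprn_ge0.
move=> x y t t1 xb yb; rewrite !big_cons; have := IH x y t t1 xb yb.
set P := \prod_(_ <- _) (_ + _); set Q := \prod_(_ <- _) _ => PQ.
have Qb : `|Q| <= b ^+ size s.
  rewrite /Q; elim: (s) => [|j s' IH']; first by rewrite big_nil normr1.
  by rewrite big_cons normrM exprS ler_pM.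
have -> : (x i + t * y i) * P - x i * Q = (x i + t * y i) * (P - Q) + t * (y i * Q).
  by rewrite mulrBr -addrA; congr (_ + _); rewrite mulrDl opprD -addrA mulrA addNr addr0.
apply: le_trans (ler_normD _ _) _; rewrite [leRHS]mulrDl lerD //.
  rewrite normrM -mulrA ler_pM //; apply: le_trans (ler_normD _ _) _.
  by rewrite lerD // normrM -[leRHS]mul1r ler_pM.
by rewrite normrM mulrC ler_wpM2r // normrM ler_pM.
Qed.

Lemma det_lipschitz m (b : R) : 0 <= b -> exists2 c, 0 <= c &
  forall (X Y : 'M[R]_m) (t : R), `|t| <= 1 ->
    (forall i j, `|X i j| <= b) -> (forall i j, `|Y i j| <= b) ->
    `|\det (X + t *: Y) - \det X| <= c * `|t|.
Proof.
move=> b0; have [c c0 cP] := prod_lipschitz (index_enum 'I_m) b0.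
exists (\sum_(s : 'S_m) c); first by apply: sumr_ge0.
move=> X Y t t1 Xb Yb; rewrite /determinant -sumrB mulr_suml.
apply: le_trans (ler_norm_sum _ _ _) _; apply: ler_sum => s _.
rewrite -mulrBr normrM normr_sign mul1r.
under eq_bigr do rewrite !mxE.
exact: (cP (fun i => X i (s i)) (fun i => Y i (s i))).
Qed.

(* The sum is one of squares of minors, each of which vanishes at L0 and is Lipschitz in t. *)
Lemma sum_pminors_gram_quadratic m n r (b : R) : 0 <= b -> exists2 C, 0 <= C &
  forall (L0 L1 : 'M[R]_(m, n)) (t : R), `|t| <= 1 ->
    (forall i j, `|L0 i j| <= b) -> (forall i j, `|L1 i j| <= b) -> (\rank L0 < r)%N ->
    sum_pminors ((L0 + t *: L1) *m (L0 + t *: L1)^T) r <= C * t ^+ 2.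
Proof.
(* Besides entries of L0 and L1, the minors contain the entries 0 and 1 of the unit block; b + 1
   bounds all of them. *)
move=> b0; have b10 : 0 <= b + 1 by rewrite addr_ge0.
have [c c0 cP] := det_lipschitz m b10.
exists (\sum_(I : {set 'I_m} | #|I| == r) \sum_(h : {ffun 'I_m -> 'I_(n + m)}) c ^+ 2).
  by do 2!(apply: sumr_ge0 => ? _); apply: sqr_ge0.
move=> L0 L1 t t1 b0P b1P; rewrite -sum_pminors_gram_eq0.
rewrite psumr_eq0; last by move=> I _; rewrite pminor_gram gram_det_ge0.
move=> /allP L0r; rewrite mulr_suml; apply: ler_sum => I Ir.
have /implyP/(_ Ir) := L0r I (mem_index_enum _).
rewrite !pminor_gram.
rewrite -(inj_eq (mulfI (x := (m`!)%:R) _)) ?pnatr_eq0 -?lt0n ?fact_gt0 // mulr0 cauchy_binet_gram.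
rewrite psumr_eq0 => [/allP d0|h _]; last exact: sqr_ge0.
rewrite mulr_suml; apply: (@le_trans _ _ ((m`!)%:R *
   \det (pminor_root (L0 + t *: L1) I *m (pminor_root (L0 + t *: L1) I)^T))).
  by rewrite ler_peMl ?gram_det_ge0 // ler1n fact_gt0.
rewrite cauchy_binet_gram; apply: ler_sum => h _.
have /eqP := d0 h (mem_index_enum _); rewrite /= => /eqP; rewrite expf_eq0 /= => /eqP dh.
pose X := \matrix_(i, j) pminor_root L0 I i (h j).
pose Y : 'M[R]_m := \matrix_(i, j) row_mx (\matrix_(i, j) (if i \in I then L1 i j else 0)) 0 i (h j).
have XY : \matrix_(i, j) pminor_root (L0 + t *: L1) I i (h j) = X + t *: Y.
  apply/matrixP => i j; rewrite !mxE; case: fintype.split => k; rewrite !mxE ?mulr0 ?addr0 //.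
  by case: ifP; rewrite ?mulr0 ?addr0.
have := cP X Y t t1; rewrite -XY dh subr0 => H.
have tt : t ^+ 2 = `|t| ^+ 2 by rewrite real_normK ?num_real.
rewrite tt -exprMn -[leLHS]real_normK ?num_real // ler_sqr ?nnegrE ?mulr_ge0 //.
apply: H => //.
- move=> i j; rewrite !mxE; case: fintype.split => k; rewrite !mxE; last first.
    by case: (_ && _); rewrite ?normr1 ?normr0 ?lerDr.
  by case: ifP; rewrite ?normr0 // (le_trans (b0P _ _)) ?lerDl.
- move=> i j; rewrite !mxE; case: fintype.split => k; rewrite !mxE ?normr0 //.
  by case: ifP; rewrite ?normr0 // (le_trans (b1P _ _)) ?lerDl.
Qed.

End Lipschitz.

(** * Cholesky factorisation and the spectral theorem *)

Definition posdef (R : realFieldType) m (G : 'M[R]_m) :=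
  G^T = G /\ forall u : 'rV[R]_m, u != 0 -> 0 < (u *m G *m u^T) 0 0.

Lemma char_poly_conj (F : fieldType) m (A P : 'M[F]_m) : P \in unitmx ->
  char_poly (P *m A *m invmx P) = char_poly A.
Proof.
move=> Pu; rewrite /char_poly.
set Pm := map_mx polyC P; set Qm := map_mx polyC (invmx P).
have PQ : Pm *m Qm = 1%:M by rewrite -map_mxM mulmxV // map_mx1.
have -> : char_poly_mx (P *m A *m invmx P) = Pm *m char_poly_mx A *m Qm.
  rewrite /char_poly_mx mulmxBr mulmxBl !map_mxM; congr (_ - _).
  by rewrite scalar_mxC -mulmxA PQ mulmx1.
by rewrite !det_mulmx mulrAC -det_mulmx PQ det1 mul1r.
Qed.

Section Cholesky.
Context (R : rcfType).

(** Induction on the size, with the Schur complement S = C - a^-1 b^T b of the top left entry a; the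
    factor is block lower triangular, with sqrt a and the factor of S on the diagonal. *)
Lemma cholesky m (G : 'M[R]_m) : posdef G -> exists2 P, P \in unitmx & G = P *m P^T.
Proof.
elim: m G => [|m IH] G [Gs Gp].
  by exists 0; [rewrite unitmxE det_mx00 unitr1|apply/matrixP => -[]].
pose G' : 'M[R]_(1 + m) := G.
pose a := (ulsubmx G') 0 0; pose b := ursubmx G'; pose C := drsubmx G'.
have blk : G' = block_mx a%:M b b^T C.
  rewrite -[LHS]submxK -mx11_scalar; congr (block_mx _ _ _ _).
  by rewrite /b trmx_ursub Gs.
have a0 : 0 < a.
  have d0 : delta_mx 0 0 != 0 :> 'rV[R]_m.+1.
    by apply/eqP => /matrixP/(_ 0 0); rewrite !mxE !eqxx => /eqP; rewrite oner_eq0.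
  have := Gp _ d0; rewrite -rowE trmx_delta -colE !mxE; congr (_ < _).
  by rewrite /a !mxE; congr (G' _ _); apply: val_inj.
pose S := C - a^-1 *: (b^T *m b).
have Cs : C^T = C by rewrite /C trmx_drsub Gs.
have Sp : posdef S.
  split; first by rewrite /S linearB linearZ /= trmx_mul trmxK Cs.
  (* Completing the square: the first coordinate of v is the one that makes the form of G at v equal
     to the form of S at u. *)
  move=> u u0; pose v : 'rV[R]_(1 + m) := row_mx (- a^-1 *: (u *m b^T)) u.
  have v0 : v != 0.
    by apply: contraNneq u0; rewrite /v -row_mx0 => /eq_row_mx[_ ->].
  have := Gp v v0; congr (_ < _).
  change ((v *m G' *m v^T) 0 0 = (u *m S *m u^T) 0 0).
  congr ((_ : 'M[R]_1) 0 0).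
  rewrite blk /v mul_row_block tr_row_mx mul_row_col mul_mx_scalar scalerA.
  rewrite mulrN divff ?gt_eqF // scaleN1r addNr mul0mx add0r /S.
  by rewrite mulmxBr -[in LHS]scalemxAl -[in RHS]scalemxAr scaleNr mulmxA [in RHS]addrC.
have [P' P'u P'S] := IH S Sp.
pose sa := Num.sqrt a.
have sa0 : sa != 0 by rewrite gt_eqF // sqrtr_gt0.
have saa : sa * sa = a by rewrite -expr2 sqr_sqrtr // ltW.
have Pu : block_mx sa%:M 0 (sa^-1 *: b^T) P' \in unitmx.
  by rewrite unitmxE det_lblock unitrM det_scalar1 unitfE sa0 -unitmxE.
exists (block_mx sa%:M 0 (sa^-1 *: b^T) P'); first exact: Pu.
change (G' = block_mx sa%:M 0 (sa^-1 *: b^T) P' *m (block_mx sa%:M 0 (sa^-1 *: b^T) P')^T).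
rewrite tr_block_mx mulmx_block blk !trmx0 !mulmx0 !mul0mx !addr0 tr_scalar_mx linearZ /= trmxK.
congr (block_mx _ _ _ _).
- by rewrite -scalar_mxM saa.
- by rewrite mul_scalar_mx scalerA divff // scale1r.
- by rewrite mul_mx_scalar scalerA divff // scale1r.
- by rewrite -P'S /S -scalemxAl -scalemxAr scalerA -invfM saa addrC subrK.
Qed.

Import complex.

(** Over R[i] the matrix is hermitian, hence unitarily diagonalisable with real eigenvalues; the
    factorisation descends because extension of scalars is injective on polynomials. *)
Lemma symmetric_char_poly_split m (S : 'M[R]_m) : S^T = S ->
  exists l : 'I_m -> R, char_poly S = \prod_i ('X - (l i)%:P).
Proof.
move=> Ss; pose f := real_complex R; pose A := map_mx f S.
have Ah : A \is hermsymmx.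
  apply: realsym_hermsym.
    apply/is_hermitianmxP/matrixP => i j; rewrite !mxE expr0 mul1r /=.
    by rewrite -[in LHS]Ss mxE.
  by apply/mxOverP => i j; rewrite mxE; apply/complex_realP; exists (S i j).
have := hermitian_spectral_diag_real Ah.
move/hermitian_normalmx: (Ah) => /orthomx_spectralP Ad /mxOverP dr.
have dR i : exists x : R, spectral_diag A 0 i = f x by apply/complex_realP.
pose l i := Re (spectral_diag A 0 i).
have lE i : spectral_diag A 0 i = f (l i) by rewrite /l; case: (dR i) => x ->.
exists l; apply: (map_poly_inj f).
rewrite map_char_poly -/A Ad.
have -> : char_poly (invmx (spectralmx A) *m diag_mx (spectral_diag A) *m spectralmx A) =
   char_poly (diag_mx (spectral_diag A)).
  rewrite -[X in _ *m X](invmxK (spectralmx A)) char_poly_conj //.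
  by rewrite unitmx_inv spectral_unit.
rewrite char_poly_trig; last by apply: diag_mx_is_trig.
rewrite rmorph_prod; apply: eq_bigr => i _.
by rewrite rmorphB /= map_polyX map_polyC /= mxE eqxx lE.
Qed.
End Cholesky.

(** * Principal minors relative to metrics on source and target *)

Section RelativePminors.
Context (R : rcfType).

Lemma sum_pminors_conj m (A P : 'M[R]_m) r : (r <= m)%N -> P \in unitmx ->
  sum_pminors (P *m A *m invmx P) r = sum_pminors A r.
Proof.
move=> rm Pu; have := char_poly_coef (P *m A *m invmx P) rm.
rewrite char_poly_conj // char_poly_coef // => /(congr1 ( *%R ((-1) ^+ r))).
by rewrite !mulrA -expr2 sqrr_sign !mul1r.
Qed.

Lemma posdef_unit m (G : 'M[R]_m) : posdef G -> G \in unitmx.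
Proof.
move=> /cholesky[P Pu ->]; by rewrite unitmx_mul unitmx_tr Pu.
Qed.

Lemma posdef_det m (G : 'M[R]_m) : posdef G -> 0 < \det G.
Proof.
move=> /cholesky[P Pu ->]; rewrite det_mulmx det_tr -expr2.
by rewrite lt0r sqr_ge0 andbT expf_neq0 //= -unitfE -unitmxE.
Qed.

(** With G = P P^T, the matrix B G^-1 is conjugate to P^-1 B P^-T, which is symmetric whenever B
    is. *)
Lemma mulmx_invmx_conj m (G P B : 'M[R]_m) : P \in unitmx -> G = P *m P^T ->
  B *m invmx G = P *m (invmx P *m B *m (invmx P)^T) *m invmx P.
Proof.
move=> Pu GP; have Gu : G \in unitmx by rewrite GP unitmx_mul unitmx_tr Pu.
rewrite !mulmxA mulmxV // mul1mx -!mulmxA; congr (_ *m _).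
apply: (can_inj (mulmxK Gu)); rewrite mulVmx // GP -!mulmxA.
by rewrite [invmx P *m _]mulmxA mulVmx // mul1mx trmx_inv mulVmx // unitmx_tr.
Qed.

Lemma relative_char_poly_split m (G B : 'M[R]_m) : posdef G -> B^T = B ->
  exists l : 'I_m -> R, char_poly (B *m invmx G) = \prod_i ('X - (l i)%:P).
Proof.
move=> /cholesky[P Pu GP] Bs; rewrite (mulmx_invmx_conj _ Pu GP) char_poly_conj //.
by apply: symmetric_char_poly_split; rewrite !trmx_mul trmxK Bs mulmxA.
Qed.

(** P^-1 N Q is the map N written in orthonormal frames of source and target; this reduces the
    statements below to plain Gram matrices. *)
Lemma relative_gram m n (G : 'M[R]_m) (P : 'M[R]_m) (N : 'M[R]_(m, n)) (Q : 'M[R]_n) r :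
  (r <= m)%N -> P \in unitmx -> G = P *m P^T ->
  sum_pminors (N *m (Q *m Q^T) *m N^T *m invmx G) r =
  sum_pminors ((invmx P *m N *m Q) *m (invmx P *m N *m Q)^T) r.
Proof.
move=> rm Pu GP; rewrite (mulmx_invmx_conj _ Pu GP) sum_pminors_conj //.
by rewrite !trmx_mul !mulmxA.
Qed.

Lemma relative_pminors_ge0 m n (G : 'M[R]_m) (H : 'M[R]_n) (N : 'M[R]_(m, n)) r :
  (r <= m)%N -> posdef G -> posdef H -> 0 <= sum_pminors (N *m H *m N^T *m invmx G) r.
Proof.
move=> rm /cholesky[P Pu GP] /cholesky[Q Qu ->].
by rewrite (relative_gram _ _ rm Pu GP) sum_pminors_gram_ge0.
Qed.

Lemma relative_pminors_eq0 m n (G : 'M[R]_m) (H : 'M[R]_n) (N : 'M[R]_(m, n)) r :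
  (r <= m)%N -> posdef G -> posdef H ->
  (sum_pminors (N *m H *m N^T *m invmx G) r == 0) = (\rank N < r)%N.
Proof.
move=> rm /cholesky[P Pu GP] /cholesky[Q Qu ->].
rewrite (relative_gram _ _ rm Pu GP) sum_pminors_gram_eq0.
rewrite mxrankMfree ?row_free_unit // -mxrank_tr trmx_mul mxrankMfree ?mxrank_tr //.
by rewrite row_free_unit unitmx_tr unitmx_inv.
Qed.

Lemma relative_pminors_mono m n (G : 'M[R]_m) (H : 'M[R]_n) (N : 'M[R]_(m, n))
    p (w : 'M[R]_(m, p)) r :
  (r <= m)%N -> posdef G -> posdef H ->
  sum_pminors (N *m H *m N^T *m invmx G) r <=
  sum_pminors ((N *m H *m N^T + w *m w^T) *m invmx G) r.
Proof.
move=> rm /cholesky[P Pu GP] /cholesky[Q Qu ->].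
rewrite (relative_gram _ _ rm Pu GP) (mulmx_invmx_conj _ Pu GP) sum_pminors_conj //.
apply: le_trans (sum_pminors_gram_mono _ (invmx P *m w) r) _.
by rewrite mulmxDr mulmxDl !trmx_mul !mulmxA.
Qed.

Lemma mulmx_bound m n p (X : 'M[R]_(m, n)) (Y : 'M[R]_(n, p)) a c :
  (forall i j, `|X i j| <= a) -> (forall i j, `|Y i j| <= c) ->
  forall i j, `|(X *m Y) i j| <= n%:R * (a * c).
Proof.
move=> Xa Yc i j; rewrite mxE; apply: le_trans (ler_norm_sum _ _ _) _.
rewrite -[n in leRHS]card_ord mulr_natl -sumr_const.
by apply: ler_sum => k _; rewrite normrM ler_pM.
Qed.

(** A diagonal entry of X X^T is the sum of the squares of a row of X. The bound b + 1 stands in for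
    sqrt b. *)
Lemma gram_bound m n (X : 'M[R]_(m, n)) b : 0 <= b ->
  (forall i, (X *m X^T) i i <= b) -> forall i j, `|X i j| <= b + 1.
Proof.
move=> b0 Xb i j; have := Xb i; rewrite mxE (bigD1 j) //= mxE -expr2.
move/(le_trans _) => /(_ (X i j ^+ 2)); rewrite lerDl => /(_ _)/=.
rewrite sumr_ge0 => [/(_ isT) Xb2|k _]; last by rewrite mxE -expr2 sqr_ge0.
have b1 : 0 <= b + 1 by rewrite addr_ge0.
rewrite -(ler_sqr) ?nnegrE // real_normK ?num_real // (le_trans Xb2) //.
rewrite sqrrD expr1n mulr1 -[leLHS]addr0 lerD ?ler01 // addrC -[leLHS]addr0.
by rewrite lerD ?sqr_ge0 // mulr2n lerDl.
Qed.

(** The Cholesky factors are chosen without any continuity, but their entries are controlled by the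
    diagonals of G^-1 = P^-T P^-1 and H = Q Q^T. Hence one constant serves for all metrics with
    bounded G^-1 and H. *)
Lemma relative_pminors_quadratic m n r (b : R) : 0 <= b -> (r <= m)%N -> exists2 C, 0 <= C &
  forall (G : 'M[R]_m) (H : 'M[R]_n) (N0 N1 : 'M[R]_(m, n)) (t : R),
    posdef G -> posdef H ->
    (forall i j, `|invmx G i j| <= b) -> (forall i j, `|H i j| <= b) ->
    (forall i j, `|N0 i j| <= b) -> (forall i j, `|N1 i j| <= b) ->
    `|t| <= 1 -> (\rank N0 < r)%N ->
    sum_pminors ((N0 + t *: N1) *m H *m (N0 + t *: N1)^T *m invmx G) r <= C * t ^+ 2.
Proof.
(* Entrywise bound for P^-1 N Q when the entries of P^-1 and Q are at most b + 1: a sum of m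
   products, then of n. *)
move=> b0 rm; pose b' := n%:R * (m%:R * ((b + 1) * b) * (b + 1)).
have b'0 : 0 <= b' by rewrite !mulr_ge0 ?ler0n ?addr_ge0.
have [C C0 CP] := sum_pminors_gram_quadratic m n r b'0.
exists C => // G H N0 N1 t /cholesky[P Pu GP] /cholesky[Q Qu ->] Gb Hb N0b N1b t1 rN.
rewrite (relative_gram _ _ rm Pu GP) mulmxDr mulmxDl -scalemxAr -scalemxAl.
have Gi : invmx G = (invmx P)^T *m (invmx P)^T^T.
  rewrite -[LHS]mul1mx (mulmx_invmx_conj _ Pu GP) mulmx1 !mulmxA mulmxV // mul1mx.
  by rewrite trmxK.
have Pb i j : `|invmx P i j| <= b + 1.
  rewrite -[invmx P]trmxK mxE; apply: gram_bound => // k.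
  by rewrite -Gi (le_trans (ler_norm _)).
have Qb : forall i j, `|Q i j| <= b + 1.
  by apply: gram_bound => // k; rewrite (le_trans (ler_norm _)).
apply: CP => //; [by apply: mulmx_bound => //; apply: mulmx_bound..|].
rewrite mxrankMfree ?row_free_unit // -mxrank_tr trmx_mul mxrankMfree ?mxrank_tr //.
by rewrite row_free_unit unitmx_tr unitmx_inv.
Qed.

End RelativePminors.

Local Open Scope classical_set_scope.
Local Open Scope ring_scope.

(** * Smooth functions *)

Section Ck.
Context {R : realType}.

Lemma near_eq_differentiable (V W : normedModType R) (f g : V -> W) x :
  {near x, f =1 g} -> differentiable f x -> differentiable g x.
Proof.
move=> fg df.
have fx : f x = g x by exact: nbhs_singleton fg.
have H : g \o shift x = cst (g x) + 'd f x +o_ 0 id.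
  apply/eqaddoP => e e0; have /diff_locally/eqaddoP/(_ e e0) := df.
  have n0 : \forall h \near 0, f (h + x) = g (h + x).
    by rewrite (near_shift x 0) /=; apply: filterS fg => h; rewrite sub0r /= subrK.
  by apply: filterS2 n0 => h /= e1; rewrite /= !fctE /= e1 fx.
have cd : continuous ('d f x) by apply: diff_continuous.
apply/diff_locallyP; rewrite (diff_unique cd H); split => //.
Qed.

Lemma is_Ck_sub (V W : normedModType R) k (A B : set V) (f : V -> W) :
  A `<=` B -> is_Ck k B f -> is_Ck k A f.
Proof.
elim: k f => [|k IH] f AB /=; first by move=> h x /AB/h.
by move=> [df Df]; split => [x /AB/df //|v]; apply: IH.
Qed.

(** [is_Ck] is a conjunction of conditions at single points on iterated derivatives of the ambient
    function, so it can be checked point by point. *)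
Lemma is_Ck_local (V W : normedModType R) k (A : set V) (f : V -> W) :
  (forall x, A x -> exists2 U, U x & is_Ck k U f) -> is_Ck k A f.
Proof.
elim: k f => [|k IH] f h /=; first by move=> x /h[U Ux]; apply.
split => [x /h[U Ux [dU _]]|v]; first exact: dU.
by apply: IH => x /h[U Ux [_ Df]]; exists U => //; apply: Df.
Qed.

(** Openness of A turns equality on A into equality near each of its points, which derivatives
    respect. *)
Lemma is_Ck_eq (V W : normedModType R) k (A : set V) (f g : V -> W) : open A ->
  (forall x, A x -> f x = g x) -> is_Ck k A f -> is_Ck k A g.
Proof.
move=> oA; elim: k f g => [|k IH] f g fg /=.
  move=> cf x Ax; have nx : {near x, f =1 g} by apply: filterS (open_nbhs_nbhs (conj oA Ax)).
  rewrite /prop_for /continuous_at -(fg x Ax); apply: cvg_trans (cf x Ax).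
  exact: near_eq_cvg nx.
move=> [df Df]; have nx x : A x -> {near x, f =1 g}.
  by move=> Ax; apply: filterS (open_nbhs_nbhs (conj oA Ax)).
split => [x Ax|v]; first exact: near_eq_differentiable (nx x Ax) (df x Ax).
by apply: IH (Df v) => x Ax; apply: near_eq_derive (nx x Ax).
Qed.

Lemma is_CkS (V W : normedModType R) k (A : set V) (f : V -> W) :
  is_Ck k.+1 A f -> is_Ck k A f.
Proof.
elim: k f => [|k IH] f [df Df]; first by move=> x /df /differentiable_continuous.
by split => // v; apply: IH.
Qed.

Lemma is_Ck_cst (V W : normedModType R) k (A : set V) (c : W) : is_Ck k A (cst c).
Proof.
elim: k c => [|k IH] c /=; first by move=> x _; apply: cst_continuous.
split => [x _ //|v].
rewrite (_ : 'D_v (cst c) = cst 0) //.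
by apply/funext => x; rewrite derive_cst.
Qed.

Lemma is_Ck_add (V W : normedModType R) k (A : set V) (f g : V -> W) : open A ->
  is_Ck k A f -> is_Ck k A g -> is_Ck k A (f + g).
Proof.
move=> oA; elim: k f g => [|k IH] f g /=.
  by move=> cf cg x Ax; apply: continuousD; [apply: cf|apply: cg].
move=> [df Df] [dg Dg]; split => [x Ax|v].
  by apply: differentiableD; [apply: df|apply: dg].
apply: is_Ck_eq (IH _ _ (Df v) (Dg v)) => // x Ax.
by rewrite deriveD //; apply: diff_derivable; [apply: df|apply: dg].
Qed.

Lemma is_Ck_sum (V W : normedModType R) k (A : set V) (I : Type) (s : seq I) (P : pred I)
    (f : I -> V -> W) : open A ->
  (forall i, is_Ck k A (f i)) -> is_Ck k A (fun x => \sum_(i <- s | P i) f i x).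
Proof.
move=> oA cf; have -> : (fun x => \sum_(i <- s | P i) f i x) = \sum_(i <- s | P i) f i.
  by apply/funext => x; rewrite fct_sumE.
by elim/big_ind: _ => [|g h|i _]; [apply: is_Ck_cst|apply: is_Ck_add|].
Qed.

Lemma is_Ck_mul (V : normedModType R) k (A : set V) (f g : V -> R) : open A ->
  is_Ck k A f -> is_Ck k A g -> is_Ck k A (f * g).
Proof.
move=> oA; elim: k f g => [|k IH] f g.
  by move=> cf cg x Ax; apply: continuousM; [apply: cf|apply: cg].
move=> Cf Cg; have cf := is_CkS Cf; have cg := is_CkS Cg.
case: Cf Cg => [df Df] [dg Dg]; split => [x Ax|v].
  by apply: differentiableM; [apply: df|apply: dg].
apply: is_Ck_eq (is_Ck_add oA (IH _ _ cf (Dg v)) (IH _ _ cg (Df v))) => // x Ax.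
by rewrite deriveM //; apply: diff_derivable; [apply: df|apply: dg].
Qed.

Lemma is_Ck_linear (V W W' : normedModType R) k (A : set V) (L : {linear W -> W'}) (f : V -> W) :
  open A -> continuous L -> is_Ck k A f -> is_Ck k A (L \o f).
Proof.
move=> oA cL; elim: k f => [|k IH] f /=.
  by move=> cf x Ax; apply: continuous_comp; [apply: cf|apply: cL].
move=> [df Df]; split => [x Ax|v].
  have dL := linear_differentiable (f x) cL.
  by apply: differentiable_comp => //; apply: df.
apply: is_Ck_eq (IH _ (Df v)) => // x Ax /=.
have dfx := df x Ax; have dL := linear_differentiable (f x) cL.
have dLf : differentiable (L \o f) x by exact: differentiable_comp.
rewrite (deriveE v dfx) (deriveE v dLf) (diff_comp dfx dL) /=.
by have /= -> := congr1 (fun h : W -> W' => h ('d f x v)) (diff_lin (f x) cL).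
Qed.

Lemma is_Ck_scalel (V W : normedModType R) k (A : set V) (f : V -> R) (w : W) :
  open A -> is_Ck k A f -> is_Ck k A (fun x => f x *: w).
Proof.
move=> oA; elim: k f => [|k IH] f /=.
  by move=> cf x Ax; apply: continuousZl; apply: cf.
move=> [df Df]; split => [x Ax|v].
  by apply: differentiableZl; apply: df.
apply: is_Ck_eq (IH _ (Df v)) => // x Ax /=.
have dfx := df x Ax.
rewrite !deriveE //; last exact: differentiableZl.
by rewrite diffZl.
Qed.

Lemma is_Ck_lin (V W : normedModType R) k (A : set V) (L : {linear V -> W}) :
  continuous L -> is_Ck k A L.
Proof.
move=> cL; case: k => [|k] /=; first by move=> x _; apply: cL.
split => [x _|v]; first exact: (linear_differentiable _ cL).
rewrite (_ : 'D_v L = cst (L v)); first exact: is_Ck_cst.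
apply/funext => x; rewrite deriveE ?diff_lin //; exact: (linear_differentiable _ cL).
Qed.


Lemma scale_is_bilinear (W : lmodType R) :
  bilinear_for (GRing.Scale.Law.clone _ _ *:%R _) (GRing.Scale.Law.clone _ _ *:%R _)
    (@GRing.scale R W : R -> W -> W).
Proof.
split=> [u'|u] a x y /=; first by rewrite scalerDl scalerA.
by rewrite scalerDr !scalerA [u * a]mulrC.
Qed.

(** Scaling is a continuous bilinear map, and its differential along the pair (f, h) is the product
    rule for vector-valued h. *)
Lemma is_diff_scale (V W : normedModType R) (f : V -> R) (h : V -> W) x :
  differentiable f x -> differentiable h x ->
  differentiable (fun y => f y *: h y) x /\
  forall v, 'd (fun y => f y *: h y) x v = f x *: 'd h x v + 'd f x v *: h x.
Proof.
move=> df dh.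
pose B := bilinear_isBilinear.Build R R W W _ _ (@GRing.scale R W) (scale_is_bilinear W).
pose sc : {bilinear R -> W -> W} := HB.pack (@GRing.scale R W : R -> W -> W) B.
have csc : continuous (fun p : R * W => sc p.1 p.2) by move=> p; apply: scale_continuous.
have dp := differentiable_pair df dh.
have ds := differentiable_bilin (f x, h x) csc.
have -> : (fun y => f y *: h y) = (fun p : R * W => sc p.1 p.2) \o (fun y => (f y, h y)) by [].
split; first exact: differentiable_comp dp ds.
move=> v; rewrite (diff_comp dp ds) /=.
have /= -> := congr1 (fun F : R * W -> W => F ('d (fun y => (f y, h y)) x v)) (diff_bilin (f x, h x) csc).
by have /= -> := congr1 (fun F : V -> R * W => F v) (diff_pair df dh).
Qed.

Lemma is_Ck_scale (V W : normedModType R) k (A : set V) (f : V -> R) (h : V -> W) :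
  open A -> is_Ck k A f -> is_Ck k A h -> is_Ck k A (fun x => f x *: h x).
Proof.
move=> oA; elim: k f h => [|k IH] f h.
  by move=> cf ch x Ax; apply: continuousZ; [apply: cf|apply: ch].
move=> Cf Ch; have cf := is_CkS Cf; have ch := is_CkS Ch.
case: Cf Ch => [df Df] [dh Dh].
have D x (Ax : A x) := is_diff_scale (df x Ax) (dh x Ax).
split => [x Ax|v]; first by case: (D x Ax).
apply: is_Ck_eq (is_Ck_add oA (IH _ _ cf (Dh v)) (IH _ _ (Df v) ch)) => // x Ax.
case: (D x Ax) => dfh dE.
by rewrite !fctE (deriveE v dfh) dE !deriveE //; [apply: df|apply: dh].
Qed.

(* The coordinate functionals [c i] and vectors [e i] express that U is finite-dimensional. *)
Lemma is_Ck_comp_coord (V U W : normedModType R) (n : nat) (c : 'I_n -> {linear U -> R}) (e : 'I_n -> U)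
    k (A : set V) (B : set U) (g : V -> U) (f : U -> W) :
  (forall i, continuous (c i)) -> (forall u, u = \sum_i c i u *: e i) ->
  open A -> (forall x, A x -> B (g x)) ->
  is_Ck k A g -> is_Ck k B f -> is_Ck k A (f \o g).
Proof.
move=> cc ce oA AB; elim: k g f AB => [|k IH] g f AB.
  by move=> cg cf x Ax; apply: continuous_comp; [apply: cg|apply/cf/AB].
move=> Cg Cf; have cg := is_CkS Cg; have cf := is_CkS Cf.
case: Cf Cg => [df Df] [dg Dg].
split => [x Ax|v]; first by apply: differentiable_comp; [apply: dg|apply/df/AB].
(* The chain rule differentiates f in the direction D_v g, which varies with x, whereas [is_Ck] only
   knows fixed directions; expanding that direction in coordinates closes the induction. *)
have S : is_Ck k A (fun x => \sum_i c i ('D_v g x) *: 'D_(e i) f (g x)).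
  apply: is_Ck_sum => // i; apply: is_Ck_scale => //.
    by apply: is_Ck_linear => //; exact: Dg.
  exact: (IH g _ AB cg (Df (e i))).
apply: is_Ck_eq S => // x Ax.
have dgx := dg x Ax; have dfx := df _ (AB x Ax).
have dfg : differentiable (f \o g) x by exact: differentiable_comp.
rewrite (deriveE v dfg) (diff_comp dgx dfx) /= (deriveE v dgx).
rewrite [in RHS](ce ('d g x v)) linear_sum; apply: eq_bigr => i _.
by rewrite linearZ (deriveE _ dfx).
Qed.

Lemma is_Ck_comp_rV (V W : normedModType R) m k (A : set V) (B : set 'rV[R]_m)
    (g : V -> 'rV[R]_m) (f : 'rV[R]_m -> W) :
  open A -> (forall x, A x -> B (g x)) ->
  is_Ck k A g -> is_Ck k B f -> is_Ck k A (f \o g).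
Proof.
pose cf (i : 'I_m) (u : 'rV[R]_m) : R := u 0 i.
have cl i : linear (cf i) by move=> a u v; rewrite /cf !mxE.
pose c i : {linear 'rV[R]_m -> R} := HB.pack (cf i) (GRing.isLinear.Build _ _ _ _ _ (cl i)).
apply: (is_Ck_comp_coord (c := c) (e := fun i => delta_mx 0 i)).
  by move=> i; apply: coord_continuous.
by move=> u; rewrite [LHS]row_sum_delta.
Qed.

Lemma is_Ck_comp_R (V W : normedModType R) k (A : set V) (B : set R)
    (g : V -> R) (f : R -> W) :
  open A -> (forall x, A x -> B (g x)) ->
  is_Ck k A g -> is_Ck k B f -> is_Ck k A (f \o g).
Proof.
apply: (is_Ck_comp_coord (n := 1) (c := fun=> idfun) (e := fun=> 1)).
  by move=> _ x.
by move=> u; rewrite big_ord1 /= [_ *: _]mulr1.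
Qed.

Lemma is_Ck_comp_RrV (V W : normedModType R) m k (A : set V) (B : set (R * 'rV[R]_m))
    (g : V -> R * 'rV[R]_m) (f : R * 'rV[R]_m -> W) :
  open A -> (forall x, A x -> B (g x)) ->
  is_Ck k A g -> is_Ck k B f -> is_Ck k A (f \o g).
Proof.
pose cf (i : 'I_m.+1) (u : R * 'rV[R]_m) : R :=
  if unlift ord0 i is Some j then u.2 0 j else u.1.
have cl i : linear (cf i).
  by move=> a u v; rewrite /cf; case: unlift => [j|] //=; rewrite !mxE.
pose c i : {linear (R * 'rV[R]_m)%type -> R} :=
  HB.pack (cf i) (GRing.isLinear.Build _ _ _ _ _ (cl i)).
pose e (i : 'I_m.+1) : R * 'rV[R]_m :=
  if unlift ord0 i is Some j then (0, delta_mx 0 j) else (1, 0).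
apply: (is_Ck_comp_coord (c := c) (e := e)).
  move=> i /= p; rewrite /cf; case: unlift => [j|]; last exact: cvg_fst.
  by apply: (continuous_comp (f := snd) (g := fun u : 'rV[R]_m => u 0 j)); [exact: cvg_snd|exact: coord_continuous].
move=> [t u]; rewrite big_ord_recl /= /cf /e unlift_none /=.
under eq_bigr do rewrite !liftK.
rewrite [in LHS](row_sum_delta u).
apply/pair_equal_spec; split => /=.
  rewrite [_ *: _]mulr1 (big_morph fst (id1 := 0) (op1 := +%R)) //.
  by rewrite big1 ?addr0 // => i _ /=; rewrite scaler0.
by rewrite scaler0 add0r (big_morph snd (id1 := 0) (op1 := +%R)).
Qed.

End Ck.

(** * Smooth functions that are flat at 0 *)

Section Flat.
Context {R : realType}.

(** The difference quotient at 0 is at most C |h|. This serves both for [flat] at 0 and for the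
    energy of a parallel section. *)
Lemma is_derive_quadratic (f : R -> R) (C e : R) : 0 <= C -> 0 < e ->
  (forall t, `|t| < e -> `|f t| <= C * t ^+ 2) -> is_derive (0 : R) (1 : R) f 0.
Proof.
move=> C0 e0 CP.
have f0 : f 0 = 0.
  by apply/eqP; rewrite -normr_le0; have := CP 0; rewrite normr0 expr0n mulr0; apply.
suff H : (fun h : R => h^-1 *: ((f \o shift 0) (h *: 1) - f 0)) @ 0^' --> (0 : R).
  by apply: DeriveDef; [apply/cvg_ex; exists 0|exact: cvg_lim H].
rewrite f0; apply/cvgr0Pnorm_le => d d0.
near=> h; rewrite /= subr0 addr0 [h *: 1]mulr1 normrZ normfV.
have h0 : h != 0 by near: h; exact: nbhs_dnbhs_neq.
rewrite mulrC ler_pdivrMr ?normr_gt0 //.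
apply: le_trans (CP h _) _; first by near: h; exact: dnbhs0_lt.
rewrite -real_normK ?num_real // expr2 mulrA ler_wpM2r //.
(* C + 1 is positive, so that one can divide by it. *)
apply: le_trans (_ : (C + 1) * `|h| <= _); first by rewrite ler_wpM2r // lerDl.
rewrite -ler_pdivlMl ?ltr_pwDr // mulrC.
by near: h; apply: dnbhs0_le; rewrite divr_gt0 // ltr_pwDr.
Unshelve. all: by end_near. Qed.

(* The functions p(1/x) exp(-1/x), extended by 0, are closed under differentiation. *)
Definition flat (p : {poly R}) (x : R) : R :=
  if 0 < x then p.[x^-1] * expR (- x^-1) else 0.


(** With y = 1/t >= 1 and n the size of p, |p(y)| <= S y^n and e^y >= y^(n+2) / (n+2)!, so two
    powers of t are left over. *)
Lemma flat_quadratic (p : {poly R}) : exists2 C, 0 <= C &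
  forall t, `|t| <= 1 -> `|flat p t| <= C * t ^+ 2.
Proof.
pose n := size p; pose S := \sum_(i < n) `|p`_i|.
have S0 : 0 <= S by apply: sumr_ge0.
exists (S * (n.+2)`!%:R); first by rewrite mulr_ge0.
move=> t t1; rewrite /flat; case: ifPn => [t0|_]; last first.
  by rewrite normr0 mulr_ge0 ?sqr_ge0 // mulr_ge0.
set y := t^-1; have y0 : 0 < y by rewrite invr_gt0.
have y1 : 1 <= y by rewrite /y invf_ge1 // -(gtr0_norm t0).
have py : `|p.[y]| <= S * y ^+ n.
  rewrite horner_coef mulr_suml; apply: le_trans (ler_norm_sum _ _ _) _.
  apply: ler_sum => i _; rewrite normrM ler_wpM2l // ger0_norm; last by rewrite exprn_ge0 // ltW.
  by rewrite ler_weXn2l // ltnW.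
have ey : expR (- y) <= (n.+2)`!%:R / y ^+ n.+2.
  rewrite expRN ler_pdivlMr ?exprn_gt0 // mulrC ler_pdivrMr ?expR_gt0 //.
  rewrite -ler_pdivrMl ?ltr0n ?fact_gt0 // mulrC.
  by apply: le_trans (expR_ge1Dxn n.+1 (ltW y0)); rewrite lerDr.
rewrite normrM [`|expR _|]ger0_norm ?expR_ge0 //.
apply: le_trans (ler_pM _ _ py ey) _ => //; rewrite ?expR_ge0 //.
have e : y ^+ n / y ^+ n.+2 = t ^+ 2.
  rewrite -addn2 exprD invfM mulrA mulfV ?mul1r -?exprVn ?invrK //.
  by rewrite expf_neq0 // gt_eqF.
by rewrite -e mulrACA mulrA.
Qed.

(** For x > 0 the derivative of p(1/x) e^(-1/x) is x^-2 (p - p')(1/x) e^(-1/x), whence the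
    polynomial X^2 (p - p'). At 0 the quadratic bound gives derivative 0. *)
Lemma is_derive_flat (p : {poly R}) (x : R) :
  is_derive x 1 (flat p) (flat ('X^2 * (p - p^`())) x).
Proof.
have [x0|x0|->] := ltgtP x 0.
- rewrite [X in is_derive _ _ _ X]/flat ltNge (ltW x0) /=.
  apply: near_eq_is_derive (is_derive_cst (0 : R) x 1).
  near=> z; rewrite /flat ltNge ifF //; apply/negbTE; rewrite negbK.
  by near: z; exact: (lt_le_nbhsl x0).
- have xn0 : x != 0 by rewrite gt_eqF.
  have dV : is_derive x 1 (fun x : R => x^-1) (- x ^- 2).
    have := is_deriveV (f := id) (x := x) (t := 1) (v := 1) xn0 (is_derive_id _ _).
    by move=> /is_derive_eq; apply; rewrite [_ *: _]mulr1.
  have d1 : is_derive x 1 (horner p \o (fun x : R => x^-1)) (p^`().[x^-1] * - x ^- 2).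
    exact: is_derive1_comp.
  have dN : is_derive x 1 (fun x : R => - x^-1) (x ^- 2).
    by have := is_deriveN dV; move/is_derive_eq; apply; rewrite opprK.
  have d2 : is_derive x 1 (expR \o (fun x : R => - x^-1)) (expR (- x^-1) * x ^- 2).
    exact: is_derive1_comp.
  have d3 := is_deriveM d1 d2.
  suff e : flat ('X^2 * (p - p^`())) x = (horner p \o (fun x : R => x^-1)) x *: (expR (- x^-1) * x ^- 2) +
      (expR \o (fun x : R => - x^-1)) x *: (p^`().[x^-1] * - x ^- 2).
    rewrite e; apply: near_eq_is_derive d3.
    near=> z; rewrite /flat ifT //; near: z.
    exact: (open_nbhs_nbhs (conj (@open_gt R 0) x0)).
  rewrite /flat x0 /= !hornerE /=.
  by rewrite /GRing.scale /= exprVn; ring.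
- set D := flat _ 0; have -> : D = 0 by rewrite /D /flat ltxx.
  have [C C0 CP] := flat_quadratic p.
  by apply: (is_derive_quadratic C0 ltr01) => t /ltW; exact: CP.
Unshelve. all: by end_near. Qed.

Lemma is_Ck_flat k (p : {poly R}) : is_Ck k [set: R] (flat p).
Proof.
elim: k p => [|k IH] p.
  by move=> x _; apply/differentiable_continuous/derivable1_diffP; case: (is_derive_flat p x).
have df x : differentiable (flat p) x by apply/derivable1_diffP; case: (is_derive_flat p x).
split => // v.
apply: (is_Ck_eq (f := fun x => flat ('X^2 * (p - p^`())) x *: v)); first exact: openT.
  move=> x _; rewrite (deriveE _ (df x)).
  have [_] := is_derive_flat p x; rewrite (deriveE _ (df x)) => <-.
  have : 'd (flat p) x (v *: (1 : R)) = v *: 'd (flat p) x 1 by rewrite linearZ.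
  by rewrite [v *: (1 : R)]mulr1 => ->; rewrite [LHS]mulrC.
by apply: is_Ck_scalel (IH _); exact: openT.
Qed.

End Flat.

(** * Bump functions on coordinate space *)

Section Bump.
Context {R : realType}.

(** The squared Euclidean distance is smooth, unlike the sup norm behind [ball]; the Euclidean ball
    lies in the sup-norm ball of the same radius, whence [bump_supp]. *)
Definition bump m (c : 'rV[R]_m) (rho : R) (y : 'rV[R]_m) : R :=
  flat 1 (rho ^+ 2 - \sum_a (y 0 a - c 0 a) ^+ 2).

Lemma is_Ck_coord m k (A : set 'rV[R]_m) a : is_Ck k A (fun y : 'rV[R]_m => y 0 a).
Proof.
pose cf (u : 'rV[R]_m) : R := u 0 a.
have cl : linear cf by move=> b u v; rewrite /cf !mxE.
pose c : {linear 'rV[R]_m -> R} := HB.pack cf (GRing.isLinear.Build _ _ _ _ _ cl).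
by apply: (@is_Ck_lin R _ _ k A c); exact: coord_continuous.
Qed.

Lemma is_Ck_bump m (c : 'rV[R]_m) rho k : is_Ck k setT (bump c rho).
Proof.
have oT : open [set: 'rV[R]_m] by exact: openT.
have h a : is_Ck k setT (fun y : 'rV[R]_m => y 0 a - c 0 a).
  have := is_Ck_add oT (is_Ck_coord k setT a) (is_Ck_cst k setT (- c 0 a)).
  exact.
have g : is_Ck k setT (fun y : 'rV[R]_m => rho ^+ 2 - \sum_a (y 0 a - c 0 a) ^+ 2).
  have S : is_Ck k setT (fun y : 'rV[R]_m => \sum_a (y 0 a - c 0 a) ^+ 2).
    by apply: is_Ck_sum => // a; exact: (is_Ck_mul oT (h a) (h a)).
  have N := is_Ck_scale oT (is_Ck_cst k setT (-1 : R)) S.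
  have := is_Ck_add oT (is_Ck_cst k setT (rho ^+ 2)) N.
  by apply: is_Ck_eq => // y _; rewrite !fctE scaleN1r.
by have := is_Ck_comp_R oT (fun _ _ => I) g (@is_Ck_flat R k 1).
Qed.

Lemma bump_ge0 m (c : 'rV[R]_m) rho y : 0 <= bump c rho y.
Proof. by rewrite /bump /flat; case: ifP => // _; rewrite hornerC mul1r expR_ge0. Qed.

Lemma bump_gt0 m (c : 'rV[R]_m) rho : 0 < rho -> 0 < bump c rho c.
Proof.
move=> r0; rewrite /bump big1 => [|a _]; last by rewrite subrr expr0n.
by rewrite subr0 /flat exprn_gt0 // hornerC mul1r expR_gt0.
Qed.

Lemma bump_supp m (c : 'rV[R]_m) rho y : 0 < rho -> ~ ball c rho y -> bump c rho y = 0.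
Proof.
move=> r0 yb; rewrite /bump /flat ifF //; apply/negbTE; rewrite subr_gt0 -leNgt.
rewrite leNgt; apply/negP => S; apply: yb; split => //= i j.
rewrite (ord1 i) /ball /= distrC -(ltr_sqr) ?nnegrE ?(ltW r0) // real_normK ?num_real //.
apply: le_lt_trans S; rewrite (bigD1 j) //= lerDl; apply: sumr_ge0 => a _.
exact: sqr_ge0.
Qed.

End Bump.

(** * Charts, tangent vectors and connections *)

Section Charts.
Context (R : realType) (m : nat) (M : manifold R m).
Local Notation dom := (@Defs.dom R m M).
Local Notation chart := (@Defs.chart R m M).
Local Notation chart_inv := (@Defs.chart_inv R m M).
Implicit Types (A O K U : set M) (x : M) (i j : nat).

Lemma chart_image_open i A : open A -> open (chart i @` (dom i `&` A)).
Proof.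
move=> oA; rewrite openE => y [x [ix Ax] <-]; rewrite /interior.
have n1 : nbhs (chart i x) (chart i @` (dom i)).
  by apply: open_nbhs_nbhs; split; [exact: chart_open|exists x].
have n2 : nbhs (chart i x) (chart_inv i @^-1` (dom i `&` A)).
  apply: (chart_inv_continuous ix); rewrite chartK //.
  by apply: open_nbhs_nbhs; split=> //; apply: openI => //; exact: dom_open.
apply: filterS2 n1 n2 => z [x' ix' <-]; rewrite /= chartK // => -[_ Ax'].
by exists x'.
Qed.

Lemma chart_image_inv i A (y : 'rV[R]_m) : (chart i @` (dom i `&` A)) y ->
  [/\ dom i (chart_inv i y), A (chart_inv i y) & chart i (chart_inv i y) = y].
Proof. by case=> x [ix Ax] <-; rewrite chartK. Qed.

Lemma chart_image_nbhs i A x : open A -> dom i x -> A x ->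
  nbhs (chart i x) (chart i @` (dom i `&` A)).
Proof.
by move=> oA ix Ax; apply: open_nbhs_nbhs; split; [exact: chart_image_open|exists x].
Qed.

Lemma smoothM_sub (W : normedModType R) A O (f : M -> W) :
  A `<=` O -> smoothM O f -> smoothM A f.
Proof.
move=> AO sf i k; apply: is_Ck_sub (sf i k) => y [x [ix Ax] <-].
by exists x => //; split=> //; exact: AO.
Qed.

Lemma smoothM_eq (W : normedModType R) A (f g : M -> W) : open A ->
  (forall x, A x -> f x = g x) -> smoothM A f -> smoothM A g.
Proof.
move=> oA fg sf i k; apply: is_Ck_eq (sf i k); first exact: chart_image_open.
by move=> y /chart_image_inv[_ Ay _] /=; exact: fg.
Qed.

Lemma smoothM_cover (W : normedModType R) A (f : M -> W) :
  (forall x, A x -> exists2 U, U x & smoothM U f) -> smoothM A f.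
Proof.
move=> h i k; apply: is_Ck_local => y [x [ix /h[U Ux sf]] <-].
by exists (chart i @` (dom i `&` U)); [exists x|exact: sf].
Qed.

(** In any other chart f is read through a transition map, which is smooth. *)
Lemma smoothM_chart (W : normedModType R) A i (f : M -> W) : open A ->
  A `<=` dom i -> smooth_on (chart i @` A) (f \o chart_inv i) -> smoothM A f.
Proof.
move=> oA Ai sf j k.
have oj : open (chart j @` (dom j `&` A)) by exact: chart_image_open.
have h : is_Ck k (chart j @` (dom j `&` A)) ((f \o chart_inv i) \o (chart i \o chart_inv j)).
  apply: (is_Ck_comp_rV oj (B := chart i @` A)) (sf k).
    by move=> y /chart_image_inv[_ Ay _]; exists (chart_inv j y).
  apply: is_Ck_sub (@chart_smooth R m M j i k) => y [x [jx Ax] <-].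
  by exists x => //; split=> //; exact: Ai.
by apply: is_Ck_eq h => // y /chart_image_inv[_ Ay _] /=; rewrite chartK //; exact: Ai.
Qed.

Lemma smoothM_cst (W : normedModType R) A (c : W) : smoothM A (fun=> c).
Proof. by move=> i k; exact: is_Ck_cst. Qed.

Lemma smoothM_add (W : normedModType R) A (f g : M -> W) : open A ->
  smoothM A f -> smoothM A g -> smoothM A (fun x => f x + g x).
Proof.
move=> oA sf sg i k.
exact: (is_Ck_add (chart_image_open oA) (sf i k) (sg i k)).
Qed.

Lemma smoothM_scale (W : normedModType R) A (f : M -> R) (g : M -> W) : open A ->
  smoothM A f -> smoothM A g -> smoothM A (fun x => f x *: g x).
Proof.
move=> oA sf sg i k.
exact: (is_Ck_scale (chart_image_open oA) (sf i k) (sg i k)).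
Qed.

Lemma smoothM_mul A (f g : M -> R) : open A ->
  smoothM A f -> smoothM A g -> smoothM A (fun x => f x * g x).
Proof.
move=> oA sf sg i k.
exact: (is_Ck_mul (chart_image_open oA) (sf i k) (sg i k)).
Qed.

Lemma smoothM_coord n A (f : M -> 'rV[R]_n) a : open A ->
  smoothM A f -> smoothM A (fun x => f x 0 a).
Proof.
move=> oA sf i k.
have := is_Ck_comp_rV (chart_image_open oA) (fun _ _ => I) (sf i k) (is_Ck_coord k setT a).
exact.
Qed.

(** Extension by zero: A is covered by its intersection with O and by the complement of K, which is
    open and on which f vanishes. *)
Lemma smoothM_supp (W : normedModType R) A O K (f : M -> W) : open A -> open O -> closed K ->
  K `<=` O -> (forall x, ~ K x -> f x = 0) -> smoothM (A `&` O) f -> smoothM A f.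
Proof.
move=> oA oO cK KO f0 sf; apply: smoothM_cover => x Ax.
have [Kx|Kx] := pselect (K x); first by exists (A `&` O) => //; split=> //; exact: KO.
exists (~` K) => //; apply: (smoothM_eq (f := fun=> 0)); first exact: closed_openC.
  by move=> y /f0 ->.
exact: smoothM_cst.
Qed.

Lemma smoothM_continuous (W : normedModType R) A (f : M -> W) x : open A ->
  smoothM A f -> A x -> {for x, continuous f}.
Proof.
move=> oA sf Ax; have [i ix] := dom_cover x.
have cf : {for chart i x, continuous (f \o chart_inv i)}.
  by apply: (sf i 0); exists x.
have cc := chart_continuous ix.
have nx : {near x, f =1 (f \o chart_inv i) \o chart i}.
  have : nbhs x (dom i) by apply: open_nbhs_nbhs; split=> //; exact: dom_open.
  by apply: filterS => y iy /=; rewrite chartK.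
have h : {for x, continuous ((f \o chart_inv i) \o chart i)} by exact: continuous_comp.
have e : ((f \o chart_inv i) \o chart i) x = f x by rewrite /= chartK.
move: h; rewrite /prop_for /continuous_at e; apply: cvg_trans.
by apply: near_eq_cvg; apply: filterS nx => y ->.
Qed.

(** A coordinate bump supported in a closed cube, extended by zero outside the chart. The image K of
    the cube is compact, hence closed in the Hausdorff space M, which makes the extension smooth. *)
Lemma smoothM_bump O x : open O -> O x -> exists (b : M -> R) (K : set M),
  [/\ smoothM setT b, forall y, 0 <= b y, 0 < b x, compact K & K `<=` O /\
    forall y, ~ K y -> b y = 0].
Proof.
move=> oO Ox; have [i ix] := dom_cover x.
have /nbhs_ballP[rho /= rho0 rhoP] := chart_image_nbhs oO ix Ox.
pose r := rho / 2; have r0 : 0 < r by rewrite divr_gt0.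
set c := chart i x in rhoP *.
pose K0 : set 'rV[R]_m := [set y | forall a, `|y 0 a - c 0 a| <= r].
have K0b y : K0 y -> ball c rho y.
  move=> Ky; split => //= a b; rewrite (ord1 a) /ball /= distrC.
  by apply: le_lt_trans (Ky b) _; rewrite /r ltr_pdivrMr // ltr_pMr // ltr1n.
have bK0 y : ball c r y -> K0 y.
  by move=> [_ Hy] b; have := Hy 0 b; rewrite /ball /= distrC => /ltW.
have cK0 : compact K0.
  have -> : K0 = [set v : 'rV[R]_m | forall a, `[c 0 a - r, c 0 a + r]%classic (v 0 a)].
    apply/seteqP; split=> y /= Hy a; have := Hy a; rewrite /= in_itv /= ler_distl //.
  exact: (@rV_compact R m (fun a => `[c 0 a - r, c 0 a + r]%classic) (fun a => @segment_compact R _ _)).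
pose K := chart_inv i @` K0.
have K0i y : K0 y -> [/\ dom i (chart_inv i y), O (chart_inv i y) & chart i (chart_inv i y) = y].
  by move=> /K0b /rhoP /chart_image_inv.
have cK : compact K.
  apply: continuous_compact cK0; apply: continuous_in_subspaceT => y /set_mem /K0i[iy _ e].
  by rewrite -[y]e; exact: chart_inv_continuous.
have clK : closed K by apply: compact_closed cK; exact: points_hausdorff.
pose b y := if `[< dom i y >] then bump c r (chart i y) else 0.
have b0 y : ~ K y -> b y = 0.
  move=> Ky; rewrite /b; case: asboolP => // iy; apply: bump_supp => //.
  by move=> /bK0 K0y; apply: Ky; exists (chart i y) => //; rewrite chartK.
exists b, K; split => //.
- have oi : open (dom i) by exact: dom_open.
  apply: (smoothM_supp openT oi clK) => //; first by move=> _ [y /K0i[iy _ _] <-].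
  rewrite setTI; apply: (smoothM_chart (i := i)) => // k.
  have oc : open (chart i @` (dom i)) by exact: chart_open.
  apply: is_Ck_eq (is_Ck_sub (@subsetT _ _) (is_Ck_bump c r k)) => // y [z iz <-] /=.
  by rewrite /b chartK //; case: asboolP.
- by move=> y; rewrite /b; case: ifP => // _; exact: bump_ge0.
- by rewrite /b; case: asboolP => // _; exact: bump_gt0.
- by split => // _ [y /K0i[_ Oy _] <-].
Qed.

End Charts.

Lemma smooth_on_differentiable (R : realType) (V W : normedModType R) (A : set V) (f : V -> W) y :
  smooth_on A f -> A y -> differentiable f y.
Proof. by move=> /(_ 1)[df _]; exact: df. Qed.

Lemma derive_comp (R : realType) (U V W : normedModType R) (g : U -> V) (f : V -> W) y v :
  differentiable g y -> differentiable f (g y) ->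
  'D_v (f \o g) y = 'D_('D_v g y) f (g y).
Proof.
move=> dg df.
by rewrite (deriveE v (differentiable_comp dg df)) (deriveE _ df) (deriveE v dg) (diff_comp dg df).
Qed.

(** * Coordinate vectors and changes of chart *)

Section TangentVectors.
Context (R : realType) (m : nat) (M : manifold R m).
Local Notation dom := (@Defs.dom R m M).
Local Notation chart := (@Defs.chart R m M).
Local Notation chart_inv := (@Defs.chart_inv R m M).
Implicit Types (A O K U : set M) (x : M) (i j : nat).

Lemma chart_at_dom x : dom (chart_at x) x.
Proof. by rewrite /chart_at; case: cid. Qed.

Lemma smoothM_differentiable (W : normedModType R) A (f : M -> W) i x :
  smoothM A f -> A x -> dom i x -> differentiable (f \o chart_inv i) (chart i x).
Proof. by move=> sf Ax ix; apply: smooth_on_differentiable (sf i) _; exists x. Qed.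

Lemma transition_differentiable i j x : dom i x -> dom j x ->
  differentiable (chart j \o chart_inv i) (chart i x).
Proof.
by move=> ix jx; apply: smooth_on_differentiable (@chart_smooth R m M i j) _; exists x.
Qed.

(** Chain rule for a change of chart. With j the preferred chart at x it translates [dfun] and
    [tangent_coord], which are defined through that chart, into derivatives in chart i. *)
Lemma derive_transition (W : normedModType R) (f : M -> W) i j x v : dom i x -> dom j x ->
  differentiable (f \o chart_inv j) (chart j x) ->
  'D_('D_v (chart j \o chart_inv i) (chart i x)) (f \o chart_inv j) (chart j x) =
  'D_v (f \o chart_inv i) (chart i x).
Proof.
move=> ix jx df; have dt := transition_differentiable ix jx.
have n := chart_image_nbhs (@dom_open R m M j) ix jx.
have -> : 'D_v (f \o chart_inv i) (chart i x) =
    'D_v ((f \o chart_inv j) \o (chart j \o chart_inv i)) (chart i x).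
  apply: near_eq_derive; near=> y => /=.
  have /chart_image_inv[_ jy _] : (chart i @` (dom i `&` dom j)) y by near: y; exact: n.
  by rewrite chartK.
have e : chart j x = (chart j \o chart_inv i) (chart i x) by rewrite /= chartK.
move: df dt; rewrite e.
set F := f \o chart_inv j; set T := chart j \o _ => df dt.
by rewrite (derive_comp v dt df).
Unshelve. all: by end_near. Qed.

Lemma dfun_coord A (f : M -> R) i a x : smoothM A f -> A x -> dom i x ->
  dfun f (coord_vect i a x) = 'D_(delta_mx 0 a : 'rV[R]_m) (f \o chart_inv i) (chart i x).
Proof.
move=> sf Ax ix; have cx := chart_at_dom x.
exact: derive_transition ix cx (smoothM_differentiable sf Ax cx).
Qed.

Lemma tangent_coordZ j x (c : R) (X : tangent x) : dom j x ->
  tangent_coord j (c *: X : tangent x) = c *: tangent_coord j X.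
Proof.
move=> jx; have dt := transition_differentiable (chart_at_dom x) jx.
by rewrite /tangent_coord !(deriveE _ dt) linearZ.
Qed.

Lemma tangent_coord_vect i j a x : dom i x -> dom j x ->
  tangent_coord j (coord_vect i a x) =
  'D_(delta_mx 0 a : 'rV[R]_m) (chart j \o chart_inv i) (chart i x).
Proof.
move=> ix jx; have cx := chart_at_dom x.
exact: derive_transition ix cx (transition_differentiable cx jx).
Qed.

(** The Jacobian of the transition from chart i to the preferred chart at x, for row vectors. *)
Definition coord_frame i x : 'M[R]_m := \matrix_(a < m) (coord_vect i a x : 'rV[R]_m).

(** The inverse is the Jacobian of the transition back. *)
Lemma coord_frame_unit i x : dom i x -> coord_frame i x \in unitmx.
Proof.
move=> ix; have cx := chart_at_dom x.
pose B : 'M[R]_m := \matrix_(b < m)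
  ('D_(delta_mx 0 b : 'rV[R]_m) (chart i \o chart_inv (chart_at x)) (chart (chart_at x) x)).
have dt := transition_differentiable cx ix.
suff e : coord_frame i x *m B = 1%:M by exact: (mulmx1_unit e).1.
apply/row_matrixP => a; rewrite row_mul rowK.
have -> : coord_vect i a x *m B = tangent_coord i (coord_vect i a x).
  rewrite /tangent_coord (deriveE _ dt) [in RHS](row_sum_delta (coord_vect i a x)) linear_sum /=.
  rewrite mulmx_sum_row; apply: eq_bigr => b _.
  by rewrite rowK linearZ (deriveE _ dt).
rewrite tangent_coord_vect // row1.
have -> : 'D_(delta_mx 0 a : 'rV[R]_m) (chart i \o chart_inv i) (chart i x) =
   'D_(delta_mx 0 a : 'rV[R]_m) id (chart i x).
  have n := chart_image_nbhs (@dom_open R m M i) ix ix.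
  apply: near_eq_derive; near=> y => /=.
  have /chart_image_inv[_ _ e] : (chart i @` (dom i `&` dom i)) y by near: y; exact: n.
  exact: e.
exact: derive_id.
Unshelve. all: by end_near. Qed.

Lemma smoothM_derive (W : normedModType R) A (f : M -> W) i v : open A -> A `<=` dom i ->
  smoothM A f -> smoothM A (fun x => 'D_v (f \o chart_inv i) (chart i x)).
Proof.
move=> oA Ai sf; apply: (smoothM_chart (i := i)) => // k.
have AiA : chart i @` A = chart i @` (dom i `&` A).
  by congr (_ @` _); apply/seteqP; split => y; [move=> Ay; split => //; exact: Ai|case].
have [_ Df] := sf i k.+1; rewrite AiA.
apply: is_Ck_eq (Df v); first exact: chart_image_open.
by move=> y /chart_image_inv[_ _ e] /=; rewrite e.
Qed.

(** [conn_smooth] speaks of global smooth fields, so a coordinate field has to be cut off by a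
    function b supported in the chart. *)
Lemma coord_field_smooth (b : M -> R) K i a : smoothM setT b -> closed K -> K `<=` dom i ->
  (forall y, ~ K y -> b y = 0) ->
  smooth_vector_field (fun x => b x *: coord_vect i a x : tangent x).
Proof.
move=> sb cK Ki b0 j; have oi := @dom_open R m M i; have oj := @dom_open R m M j.
have oij : open (dom j `&` dom i) by exact: openI.
apply: (smoothM_supp oj oi cK Ki) => [x /b0 -> |].
  by rewrite scale0r /tangent_coord derive0.
apply: (smoothM_eq (f := fun x => b x *:
  'D_(delta_mx 0 a : 'rV[R]_m) (chart j \o chart_inv i) (chart i x))) => //.
  by move=> x [jx ix]; rewrite (tangent_coordZ _ _ jx) (tangent_coord_vect a ix jx).
apply: smoothM_scale => //; first by apply: smoothM_sub sb.
apply: smoothM_derive => //.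
by apply: smoothM_sub (fun k => @chart_smooth R m M k j) => x [].
Qed.

Lemma dfun_mul A (f h : M -> R) x (X : tangent x) : smoothM A f -> smoothM A h -> A x ->
  dfun (fun y => f y * h y) X = f x * dfun h X + h x * dfun f X.
Proof.
move=> sf sh Ax; have cx := chart_at_dom x.
have df := smoothM_differentiable sf Ax cx; have dh := smoothM_differentiable sh Ax cx.
have := @deriveM R _ _ _ (chart (chart_at x) x) X (diff_derivable df) (diff_derivable dh).
by rewrite /= chartK.
Qed.

Lemma dfun_cst (c : R) x (X : tangent x) : dfun (fun=> c) X = 0.
Proof. exact: derive_cst. Qed.

End TangentVectors.

(** * The connection in a local frame *)

Section Connection.
Context (R : realType) (m : nat) (M : manifold R m) (n : nat) (E : vector_bundle M n)
  (nab : linear_connection E).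
Local Notation dom := (@Defs.dom R m M).
Local Notation chart := (@Defs.chart R m M).
Local Notation chart_inv := (@Defs.chart_inv R m M).
Local Notation tdom := (@Defs.tdom R m M n E).
Implicit Types (s t : forall x, E x) (x : M) (i : nat) (j : tindex E).

Lemma smooth_section_scale (f : M -> R) s : smoothM setT f -> smooth_section s ->
  smooth_section (fun y => f y *: s y).
Proof.
move=> sf ss j.
have oj : open (tdom j) := @tdom_open R m M n E j.
apply: (smoothM_eq (f := fun y => f y *: triv j y (s y))) => //.
  by move=> y _; rewrite linearZ.
by apply: smoothM_scale => //; apply: smoothM_sub sf.
Qed.

Lemma smooth_section0 : smooth_section (fun y => 0 : E y).
Proof.
move=> j; apply: (smoothM_eq (f := fun=> 0)); first exact: tdom_open.
  by move=> y _; rewrite linear0.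
exact: smoothM_cst.
Qed.

Lemma smooth_section_add s t : smooth_section s -> smooth_section t ->
  smooth_section (fun y => s y + t y).
Proof.
move=> ss st j.
have oj : open (tdom j) := @tdom_open R m M n E j.
apply: (smoothM_eq (f := fun y => triv j y (s y) + triv j y (t y))) => //.
  by move=> y _; rewrite linearD.
exact: smoothM_add.
Qed.

Lemma conn0 x : nab (fun y => 0 : E y) x = 0.
Proof.
apply/lfunP => X; rewrite zero_lfunE.
have := conn_leibniz (x := x) nab (smoothM_cst setT (0 : R)) smooth_section0 X.
rewrite /= scale0r addr0 scaler0 => <-; congr (nab _ x X).
by apply: functional_extensionality_dep => y; rewrite scale0r.
Qed.

Lemma conn_sum (I : Type) (r : seq I) (t : I -> forall x, E x) x :
  (forall k, smooth_section (t k)) ->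
  smooth_section (fun y => \sum_(k <- r) t k y) /\
  nab (fun y => \sum_(k <- r) t k y) x = \sum_(k <- r) nab (t k) x.
Proof.
move=> st; elim: r => [|k r [IHs IH]].
  have -> : (fun y => \sum_(k <- [::]) t k y) = (fun y => 0 : E y).
    by apply: functional_extensionality_dep => y; rewrite big_nil.
  by rewrite big_nil conn0; split => //; exact: smooth_section0.
have -> : (fun y => \sum_(l <- k :: r) t l y) = (fun y => t k y + \sum_(l <- r) t l y).
  by apply: functional_extensionality_dep => y; rewrite big_cons.
rewrite big_cons connD // IH; split => //; exact: smooth_section_add.
Qed.

(* Connections only act on global sections, so the local frame is cut off by a bump
   function b; the formula follows from the Leibniz rule applied to both sides of
   b^2 s = sum_k (b s^k) (b e_k), wherever b > 0. *)
Lemma local_connection i j x0 : dom i x0 -> tdom j x0 ->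
  exists (U : set M) (G : 'I_m -> 'I_n -> M -> 'rV[R]_n),
  [/\ open U, U x0, U `<=` dom i `&` tdom j,
      forall a k x, U x -> {for x, continuous (G a k)}
    & forall s, smooth_section s -> forall x, U x -> forall a,
      triv j x (nab s x (coord_vect i a x)) =
      'D_(delta_mx 0 a : 'rV[R]_m) ((fun y => triv j y (s y)) \o chart_inv i) (chart i x)
      + \sum_k (triv j x (s x)) 0 k *: G a k x].
Proof.
move=> ix0 jx0.
have oi : open (dom i) := @dom_open R m M i.
have oj : open (tdom j) := @tdom_open R m M n E j.
have oO : open (dom i `&` tdom j) by exact: openI.
have [b [K [sb b0 bx0 cK [KO bK]]]] := smoothM_bump oO (conj ix0 jx0).
have clK : closed K by apply: compact_closed cK; exact: points_hausdorff.
have Ki : K `<=` dom i by move=> y /KO[].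
have Kj : K `<=` tdom j by move=> y /KO[].
have UK y : 0 < b y -> K y.
  by move=> by0; apply: contrapT => /bK e; rewrite e ltxx in by0.
pose e k y : E y := b y *: triv_inv j y (delta_mx 0 k).
have se k : smooth_section (e k).
  move=> j'; have oj' : open (tdom j') := @tdom_open R m M n E j'.
  apply: (smoothM_supp oj' oj clK Kj) => [y /bK by0|].
    by rewrite /e by0 scale0r linear0.
  have oI : open (tdom j' `&` tdom j) by exact: openI.
  apply: (smoothM_eq (f := fun y => b y *: triv j' y (triv_inv j y (delta_mx 0 k)))) => //.
    by move=> y _; rewrite /e linearZ.
  apply: smoothM_scale => //; first exact: smoothM_sub sb.
  by rewrite setIC; exact: triv_smooth.
have sX a : smooth_vector_field (fun x => b x *: coord_vect i a x : tangent x).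
  exact: coord_field_smooth sb clK Ki bK.
pose Db a y := 'D_(delta_mx 0 a : 'rV[R]_m) (b \o chart_inv i) (chart i y).
(* These are the connection coefficients. As [e k] is b times a frame vector, its derivative along
   the coordinate vector is d_a b times that frame vector plus b times the coefficient.
   Differentiating along b times the coordinate vector and dividing by b makes [conn_smooth]
   applicable, which yields continuity. *)
pose G a k y := (b y)^-1 *: ((b y)^-1 *: triv j y (nab (e k) y (b y *: coord_vect i a y : tangent y))
   - Db a y *: delta_mx 0 k).
have cb y : {for y, continuous b} by apply: (smoothM_continuous openT sb).
exists [set y | 0 < b y], G; split.
- apply: (open_comp (f := b) (D := [set r | 0 < r])); last exact: open_gt.
  by move=> y _; exact: cb.
- exact: bx0.
- by move=> y /= /UK /KO.
- move=> a k y /= by0; have [iy jy] := KO _ (UK _ by0).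
  have cbV : {for y, continuous (fun z => (b z)^-1)} by apply: continuousV; [rewrite gt_eqF|exact: cb].
  apply: continuousZ; first exact: cbV.
  apply: continuousB.
    apply: continuousZ; first exact: cbV.
    exact: (smoothM_continuous oj (conn_smooth nab (se k) (sX a) j)).
  apply: continuousZl.
  apply: (smoothM_continuous oi) => //.
  by apply: smoothM_derive => //; exact: smoothM_sub sb.
- move=> s ss x /= bx0' a; have [ix jx] := KO _ (UK _ bx0').
pose c k y := triv j y (s y) 0 k.
pose f k y := b y * c k y.
have sc k : smoothM (tdom j) (c k) by apply: smoothM_coord => //; exact: ss.
have sf k : smoothM setT (f k).
  apply: (smoothM_supp openT oj clK Kj) => [y /bK by0|]; first by rewrite /f by0 mul0r.
  by rewrite setTI; apply: smoothM_mul => //; exact: smoothM_sub sb.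
have sbb : smoothM setT (fun y => b y * b y) by apply: smoothM_mul => //; exact: openT.
have bs : (fun y => (b y * b y) *: s y) = (fun y => \sum_k f k y *: e k y).
  apply: functional_extensionality_dep => y; have [Ky|/bK by0] := pselect (K y); last first.
    by rewrite by0 mul0r scale0r big1 // => k _; rewrite /e by0 scale0r scaler0.
  have jy := Kj _ Ky.
  rewrite -[in LHS](trivK jy (s y)) [in LHS](row_sum_delta (triv j y (s y))).
  rewrite linear_sum scaler_sumr; apply: eq_bigr => k _.
  by rewrite linearZ /= /e /f !scalerA mulrAC.
pose X := coord_vect i a x.
have := congr1 (fun t => triv j x (nab t x X)) bs.
rewrite (conn_sum _ _ (fun k => smooth_section_scale (sf k) (se k))).2.
rewrite (conn_leibniz (x := x) nab sbb ss X) sum_lfunE !linear_sum linearD !linearZ /=.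
rewrite (eq_bigr (fun k => (b x * dfun (c k) X + c k x * dfun b X) * b x *: delta_mx 0 k
     + b x *: (c k x *: triv j x (nab (e k) x X)))); last first.
  move=> k _; rewrite (conn_leibniz (x := x) nab (sf k) (se k) X) linearD !linearZ /=.
  rewrite /e linearZ /= triv_invK // scalerA.
  rewrite (dfun_mul X (smoothM_sub (@subsetT _ _) sb) (sc k) jx) /f scalerA.
  by rewrite mulrC; congr (_ + _ *: _); rewrite mulrC.
have bn0 : b x != 0 by rewrite gt_eqF.
rewrite (dfun_mul X sb sb I) => H.
have db : dfun b X = Db a x by exact: (dfun_coord a sb I ix).
have SL : triv j x (s x) = \sum_k c k x *: delta_mx 0 k by rewrite -row_sum_delta.
have D1 : 'D_(delta_mx 0 a : 'rV[R]_m) ((fun y => triv j y (s y)) \o chart_inv i) (chart i x) =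
    \sum_k dfun (c k) X *: delta_mx 0 k.
  rewrite [LHS]row_sum_delta; apply: eq_bigr => k _; congr (_ *: _).
  have dt := smoothM_differentiable (ss j) jx ix.
  rewrite (derive_mx (diff_derivable dt)) mxE.
  by rewrite (dfun_coord a (sc k) jx ix).
apply: (scalerI (mulf_neq0 bn0 bn0)).
have -> : (b x * b x) *: triv j x (nab s x (coord_vect i a x)) =
   \sum_k (((b x * dfun (c k) X + c k x * dfun b X) * b x) *: delta_mx 0 k +
     b x *: (c k x *: triv j x (nab (e k) x X))) -
   (b x * dfun b X + b x * dfun b X) *: triv j x (s x).
  by rewrite -H addrC addKr.
rewrite [in LHS]SL D1 -big_split /= !scaler_sumr -sumrB.
apply: eq_bigr => k _; rewrite /G -db.
have -> : nab (e k) x (b x *: coord_vect i a x : tangent x) = b x *: nab (e k) x X by rewrite linearZ.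
have -> : triv j x (b x *: nab (e k) x X) = b x *: triv j x (nab (e k) x X) by rewrite linearZ.
apply/rowP => l; rewrite !mxE -/(c k x).
by field.
Qed.
End Connection.

(** * Continuity and integration *)

(** An induction principle for compact sets, turning local bounds into uniform ones. It is
    compactness in near-covering form, for the filter on sets V generated by the conditions that V
    contain a given set satisfying P. *)
Lemma compact_subset_union (X : topologicalType) (K : set X) (P : set X -> Prop) :
  P set0 -> (forall A B, P A -> P B -> P (A `|` B)) ->
  (forall x, K x -> exists2 U, nbhs x U & P U) ->
  compact K -> exists2 Q, P Q & K `<=` Q.
Proof.
move=> P0 PU h cK.
pose F : set_system (set X) := [set W | exists2 Q, P Q & forall V, Q `<=` V -> W V].
have FF : Filter F.
  split; first by exists set0.
    move=> W1 W2 [Q1 P1 h1] [Q2 P2 h2]; exists (Q1 `|` Q2); first exact: PU.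
    by move=> V QV; split; [apply: h1|apply: h2] => y Qy; apply: QV; [left|right].
  by move=> W1 W2 W12 [Q PQ hQ]; exists Q => // V /hQ /W12.
have /compact_near_coveringP nc := cK.
have [x Kx|Q PQ hQ] := nc _ F (fun V x => V x) FF; last by exists Q => //; exact: hQ.
have [U nU UP] := h x Kx; exists (U, [set V | U `<=` V]) => /=.
  by split => //; exists U.
by move=> [y V] /= [Uy UV]; exact: UV.
Qed.

Section ContinuousMatrix.
Context {R : realType} {T : topologicalType} (x : T).

Lemma continuous_at_sum (I : Type) (r : seq I) (P : pred I) (f : I -> T -> R) :
  (forall i, {for x, continuous (f i)}) ->
  {for x, continuous (fun y => \sum_(i <- r | P i) f i y)}.
Proof.
move=> cf; elim: r => [|i r IH].
  rewrite (_ : (fun y => _) = cst 0); first exact: cst_continuous.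
  by apply/funext => y; rewrite big_nil.
rewrite (_ : (fun y => _) = (fun y => (if P i then f i y else 0) + \sum_(j <- r | P j) f j y)).
  by apply: continuousD => //; case: (P i); [exact: cf|exact: cst_continuous].
by apply/funext => y; rewrite big_cons; case: ifP => // _; rewrite add0r.
Qed.

Lemma continuous_at_prod (I : Type) (r : seq I) (f : I -> T -> R) :
  (forall i, {for x, continuous (f i)}) ->
  {for x, continuous (fun y => \prod_(i <- r) f i y)}.
Proof.
move=> cf; elim: r => [|i r IH].
  rewrite (_ : (fun y => _) = cst 1); first exact: cst_continuous.
  by apply/funext => y; rewrite big_nil.
rewrite (_ : (fun y => _) = (fun y => f i y * \prod_(j <- r) f j y)).
  by apply: continuousM => //; exact: cf.
by apply/funext => y; rewrite big_cons.
Qed.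

Lemma continuous_at_det m (A : T -> 'M[R]_m) :
  (forall i j, {for x, continuous (fun y => A y i j)}) ->
  {for x, continuous (fun y => \det (A y))}.
Proof.
move=> cA; apply: continuous_at_sum => s; apply: continuousM; first exact: cst_continuous.
exact: continuous_at_prod.
Qed.

Lemma continuous_at_mulmx m n p (A : T -> 'M[R]_(m, n)) (B : T -> 'M[R]_(n, p)) :
  (forall i j, {for x, continuous (fun y => A y i j)}) ->
  (forall i j, {for x, continuous (fun y => B y i j)}) ->
  forall i j, {for x, continuous (fun y => (A y *m B y) i j)}.
Proof.
move=> cA cB i j.
rewrite (_ : (fun y => _) = fun y => \sum_k A y i k * B y k j).
  by apply: continuous_at_sum => k; apply: continuousM; [exact: cA|exact: cB].
by apply/funext => y; rewrite mxE.
Qed.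

Lemma continuous_at_sum_pminors m (A : T -> 'M[R]_m) r :
  (forall i j, {for x, continuous (fun y => A y i j)}) ->
  {for x, continuous (fun y => sum_pminors (A y) r)}.
Proof.
move=> cA; apply: continuous_at_sum => I; apply: continuous_at_det => i j.
rewrite (_ : (fun y => _) = fun y => if i \in I then A y i j else (i == j)%:R).
  by case: (i \in I); [exact: cA|exact: cst_continuous].
by apply/funext => y; rewrite mxE.
Qed.

Lemma near_eq_continuous (f h : T -> R) :
  {near x, f =1 h} -> {for x, continuous f} -> {for x, continuous h}.
Proof.
move=> fh; rewrite /prop_for /continuous_at -(nbhs_singleton fh); apply: cvg_trans.
exact: near_eq_cvg fh.
Qed.

(** Cramer's rule; invertibility near x keeps [invmx] away from its default value at singular
    matrices. *)
Lemma continuous_at_invmx m (A : T -> 'M[R]_m) : (\forall y \near x, A y \in unitmx) ->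
  (forall i j, {for x, continuous (fun y => A y i j)}) ->
  forall i j, {for x, continuous (fun y => invmx (A y) i j)}.
Proof.
move=> uA cA i j.
apply: (near_eq_continuous
  (f := fun y => (\det (A y))^-1 * ((-1) ^+ (j + i) * \det (row' j (col' i (A y)))))).
  by apply: filterS uA => y uy; rewrite /invmx uy !mxE.
apply: continuousM.
  apply: continuousV; last exact: continuous_at_det.
  by have := nbhs_singleton uA; rewrite unitmxE unitfE.
apply: continuousM; first exact: cst_continuous.
apply: continuous_at_det => k l.
rewrite (_ : (fun y => _) = fun y => A y (lift j k) (lift i l)); first exact: cA.
by apply/funext => y; rewrite !mxE.
Qed.

Lemma bounded_near_mx m n (A : T -> 'M[R]_(m, n)) :
  (forall i j, {for x, continuous (fun y => A y i j)}) ->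
  exists2 C, 0 <= C & \forall y \near x, forall i j, `|A y i j| <= C.
Proof.
move=> cA; pose f y := \sum_i \sum_j `|A y i j|.
have cf : {for x, continuous f}.
  apply: continuous_at_sum => i; apply: continuous_at_sum => j.
  apply: (continuous_comp (f := fun y => A y i j) (g := fun z : R => `|z|)).
    exact: cA.
  exact: norm_continuous.
have f0 y : 0 <= f y by do 2!(apply: sumr_ge0 => ? _).
exists (f x + 1); first by rewrite addr_ge0.
have nf : \forall y \near x, f y < f x + 1.
  by apply: (cf [set z | z < f x + 1]); apply: lt_nbhsl; rewrite ltrDl.
apply: filterS nf => y /ltW fy i j; apply: le_trans fy.
rewrite /f (bigD1 i) //= (bigD1 j) //= -addrA lerDl.
by rewrite addr_ge0 // sumr_ge0 // => ? _; rewrite sumr_ge0.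
Qed.

End ContinuousMatrix.

(** * Comparison of integrals of nonnegative functions *)

Section LowerIntegral.
Context d (T : measurableType d) (R : realType) (mu : {measure set T -> \bar R}).
Import HBNNSimple.
Local Open Scope ereal_scope.

(* As the integral of a nonnegative function is a supremum over the simple functions
   below it, none of the following needs measurability of the integrands. *)
Lemma ge0_integral_mono (D : set T) (f h : T -> \bar R) :
  (forall x, D x -> 0 <= f x) -> (forall x, D x -> f x <= h x) ->
  \int[mu]_(x in D) f x <= \int[mu]_(x in D) h x.
Proof.
move=> f0 fh; have h0 x : D x -> 0 <= h x by move=> Dx; apply: le_trans (f0 x Dx) (fh x Dx).
rewrite !ge0_integralE //; apply: le_ereal_sup => _ [k kf <-]; exists k => // x.
apply: le_trans (kf x) _; rewrite /patch; case: ifPn => // /set_mem; exact: fh.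
Qed.

(** A simple function below f on D, plus c times the indicator of U, is a simple function below h.
    Finiteness of [mu U] allows moving its term across the inequality before taking the supremum. *)
Lemma ge0_integral_superadditive (D U : set T) (f h : T -> \bar R) (c : R) :
  (0 <= c)%R -> d.-measurable U -> U `<=` D -> mu U < +oo ->
  (forall x, D x -> 0 <= f x) ->
  (forall x, D x -> f x + (c * \1_U x)%:E <= h x) ->
  \int[mu]_(x in D) f x + c%:E * mu U <= \int[mu]_(x in D) h x.
Proof.
move=> c0 mU UD finU f0 fh.
have h0 x : D x -> 0 <= h x.
  by move=> Dx; apply: le_trans (fh x Dx); rewrite adde_ge0 ?f0 // lee_fin mulr_ge0.
have fU : mu U \is a fin_num by rewrite ge0_fin_numE.
have cU : c%:E * mu U \is a fin_num by rewrite fin_numM.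
rewrite -leeBrDr // !ge0_integralE //; apply: ge_ereal_sup => _ [k kf <-].
rewrite leeBrDr //.
pose l := add_nnsfun k (scale_nnsfun (indic_nnsfun R mU) c0).
have -> : sintegral mu k + c%:E * mu U = sintegral mu l.
  rewrite /l sintegralD; congr (_ + _).
  by rewrite sintegralrM sintegral_indic.
apply: ereal_sup_ubound; exists l => // x; rewrite /l /=.
have := kf x; rewrite /patch; case: ifPn => Dx kx.
  apply: le_trans (fh x (set_mem Dx)).
  by rewrite EFinD leeD2r.
have xU : U x -> False by move=> Ux; move/negP: Dx; apply; apply/mem_set/UD.
have -> : mindic R mU x = 0%R by rewrite /mindic indicE memNset.
by rewrite mulr0 addr0; exact: kx.
Qed.

End LowerIntegral.

Section IteratedIntegral.
Context {R : realType}.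
Local Open Scope ereal_scope.

Lemma integral_rV_ge0 m (f : 'rV[R]_m -> \bar R) : (forall y, 0 <= f y) -> 0 <= integral_rV f.
Proof.
elim: m f => [|m IH] f f0 /=; first exact: f0.
by apply: integral_ge0 => x _; apply: IH.
Qed.

Lemma integral_rV_mono m (f h : 'rV[R]_m -> \bar R) : (forall y, 0 <= f y) ->
  (forall y, f y <= h y) -> integral_rV f <= integral_rV h.
Proof.
elim: m f h => [|m IH] f h f0 fh /=; first exact: fh.
apply: ge0_integral_mono => x _; first exact: integral_rV_ge0.
exact: IH.
Qed.

Lemma eq_integral_rV m (f h : 'rV[R]_m -> \bar R) : f =1 h -> integral_rV f = integral_rV h.
Proof. by move=> /funext ->. Qed.

(** [ball] on row vectors is a sup-norm cube, a product of intervals of length 2 rho, so its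
    indicator factors and the iterated integral splits. *)
Lemma integral_rV_ball m (c : 'rV[R]_m) (rho k : R) : (0 < rho)%R -> (0 <= k)%R ->
  integral_rV (fun y => (k * \1_(ball c rho) y)%:E) = (k * (2 * rho) ^+ m)%:E.
Proof.
move=> rho0; elim: m c k => [|m IH] c k k0 /=.
  by rewrite expr0 indicE mem_set //; split => // i [].
pose c0 : R := c 0%R ord0; pose c1 : 'rV[R]_m := rsubmx (c : 'rV_(1 + m)).
have e x (y : 'rV[R]_m) : (\1_(ball c rho) (row_mx x%:M y : 'rV[R]_m.+1) : R) =
    (\1_(ball c0 rho) x * \1_(ball c1 rho) y)%R.
  rewrite !indicE -natrM mulnb; congr ((nat_of_bool _)%:R); apply/idP/andP => [/set_mem[_ H]|].
    split; apply/mem_set.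
      have := H 0%R (lshift m (0%R : 'I_1) : 'I_m.+1); rewrite (row_mxEl (x%:M : 'rV[R]_1) y) mxE /=.
      by rewrite /c0; congr (ball (c _ _) _ _); apply: val_inj.
    split => // i j; have := H i (rshift 1 j : 'I_m.+1).
    by rewrite (row_mxEr (x%:M : 'rV[R]_1) y) mxE.
  move=> [/set_mem Hx /set_mem[_ Hy]]; apply/mem_set; split => // i j.
  rewrite (ord1 i); case: (splitP (j : 'I_(1 + m))) => j' jj'.
    have -> : j = (lshift m j' : 'I_m.+1) by apply: val_inj.
    rewrite (row_mxEl (x%:M : 'rV[R]_1) y) mxE (ord1 j') eqxx.
    by have -> : lshift m (0%R : 'I_1) = ord0 :> 'I_m.+1 by apply: val_inj.
  have -> : j = (rshift 1 j' : 'I_m.+1) by apply: val_inj.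
  by have := Hy 0%R j'; rewrite (row_mxEr (x%:M : 'rV[R]_1) y) mxE.
under eq_integral => x _.
  rewrite (eq_integral_rV (h := fun y => ((k * \1_(ball c0 rho) x) * \1_(ball c1 rho) y)%:E)).
    rewrite IH ?mulr_ge0 // mulrAC EFinM; over.
  by move=> y; rewrite e mulrA.
rewrite /= ge0_integralZl_EFin //; last 2 first.
- by apply/measurable_EFinP; exact: measurable_indic (measurable_ball _ _).
- by rewrite mulr_ge0 // exprn_ge0 // mulr_ge0 // ltW.
rewrite integral_indic // ?setIT; last exact: measurable_ball.
rewrite [X in _ * X = _](_ : _ = (rho *+ 2)%:E); last exact: lebesgue_measure_ball (ltW rho0).
by rewrite -(mulr_natl rho 2) -EFinM exprSr mulrA.
Qed.

End IteratedIntegral.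

(** * The vertical tensor *)

Section InnerProduct.
Context (R : realType) (V : lmodType R) (b : V -> V -> R) (hb : inner_product b).

Lemma inner0l w : b 0 w = 0.
Proof.
by have [bl _ _] := hb; have := bl 1 0 0 w; rewrite scaler0 addr0 mul1r -[X in X = _]addr0 => /addrI <-.
Qed.

Lemma innerZl c u w : b (c *: u) w = c * b u w.
Proof. by have [bl _ _] := hb; rewrite -[c *: u]addr0 bl inner0l addr0. Qed.

Lemma inner_expand_orthogonal (c d q : R) (e u v : V) : b u e = 0 -> b v e = 0 ->
  b (c *: e + q *: u) (d *: e + q *: v) = c * d * b e e + q ^+ 2 * b u v.
Proof.
move=> ue ve; have [bl bs _] := hb.
rewrite bl innerZl [b e (_ + _)]bs [b u (_ + _)]bs !bl !innerZl ve [b e u]bs ue [b v u]bs.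
by ring.
Qed.

Lemma inner_ge0 u : 0 <= b u u.
Proof.
have [-> |u0] := eqVneq u 0; first by rewrite inner0l.
by have [_ _ p] := hb; exact/ltW/p.
Qed.

Lemma inner_suml (I : Type) (r : seq I) (c : I -> R) (v : I -> V) w :
  b (\sum_(i <- r) c i *: v i) w = \sum_(i <- r) c i * b (v i) w.
Proof.
have [bl _ _] := hb; elim: r => [|i r IH]; first by rewrite !big_nil inner0l.
by rewrite !big_cons bl IH.
Qed.

Lemma inner_sumr (I : Type) (r : seq I) (c : I -> R) (v : I -> V) w :
  b w (\sum_(i <- r) c i *: v i) = \sum_(i <- r) c i * b w (v i).
Proof.
have [_ bs _] := hb; rewrite bs inner_suml; apply: eq_bigr => i _.
by rewrite bs.
Qed.

Lemma inner_gram m (v : 'I_m -> V) (u w : 'rV[R]_m) :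
  b (\sum_a u 0 a *: v a) (\sum_c w 0 c *: v c) =
  (u *m (\matrix_(a, c) b (v a) (v c)) *m w^T) 0 0.
Proof.
rewrite inner_sumr mxE; apply: eq_bigr => c _.
rewrite inner_suml mulrC !mxE; congr (_ * _); apply: eq_bigr => a _.
by rewrite mxE.
Qed.

Lemma inner_posdef m (v : 'I_m -> V) :
  (forall u : 'rV[R]_m, \sum_a u 0 a *: v a = 0 -> u = 0) -> posdef (\matrix_(a, c) b (v a) (v c)).
Proof.
move=> free; have [_ bs bp] := hb; split.
  by apply/matrixP => a c; rewrite !mxE bs.
move=> u u0; rewrite -inner_gram; apply: bp.
by apply: contra_neq u0; exact: free.
Qed.

End InnerProduct.

(** Coordinates in a basis of the image factor N through as many rows as the image has dimensions;
    conversely a row basis of N spans the image because the v a span V. *)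
Lemma rank_limg (K : fieldType) (V : vectType K) m n (T : 'Hom(V, 'rV[K]_n)) (v : 'I_m -> V) :
  (forall X, exists u : 'I_m -> K, X = \sum_a u a *: v a) ->
  \rank (\matrix_a T (v a)) = \dim (limg T).
Proof.
move=> sp; set N := \matrix_a _; apply/eqP; rewrite eqn_leq; apply/andP; split.
  pose B := vbasis (limg T).
  have -> : N = (\matrix_(a, k) coord B k (T (v a))) *m (\matrix_k tnth B k).
    apply/row_matrixP => a; rewrite row_mul !rowK mulmx_sum_row.
    rewrite [LHS](coord_vbasis (memv_img T (memvf (v a)))).
    by apply: eq_bigr => k _; rewrite rowK !mxE (tnth_nth 0).
  exact: leq_trans (mxrankM_maxr _ _) (rank_leq_row _).
pose X := [seq row k (row_base N) | k <- enum 'I_(\rank N)].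
have szX : size X = \rank N by rewrite size_map -cardE card_ord.
rewrite -[leqRHS]szX; apply: leq_trans (dim_span X); apply: dimvS.
apply/subvP => _ /memv_imgP[w _ ->].
have [u ->] := sp w; rewrite linear_sum; apply: memv_suml => a _.
rewrite linearZ; apply: memvZ; change (T (v a) \in <<X>>%VS).
have : (row a N <= row_base N)%MS by rewrite eq_row_base row_sub.
case/submxP => D; rewrite rowK => ->; rewrite mulmx_sum_row; apply: memv_suml => k _.
by apply/memvZ/memv_span/map_f; rewrite mem_enum.
Qed.

Section VerticalTensor.
Context (R : realType) (m : nat) (M : manifold R m) (g : riemannian_metric M)
  (n : nat) (E : riemannian_vector_bundle M n).
Local Notation dom := (@Defs.dom R m M).
Local Notation tdom := (@Defs.tdom R m M n E).
Implicit Types (s : forall x, E x) (x : M) (r i : nat) (j : tindex E).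

Definition fibre_gram j x : 'M[R]_n :=
  \matrix_(k, l) fib E x (triv_inv j x (delta_mx 0 k)) (triv_inv j x (delta_mx 0 l)).

Definition nabla_mx s i j x : 'M[R]_(m, n) :=
  \matrix_a triv j x (nabla E s x (coord_vect i a x)).

(** The matrix of the form <nabla s, nabla s> in the coordinate frame, in a factored form that
    displays the fibre metric. *)
Definition vertical_mx s i j x : 'M[R]_m :=
  nabla_mx s i j x *m fibre_gram j x *m (nabla_mx s i j x)^T.

Lemma coord_frame_sum i x (u : 'rV[R]_m) :
  \sum_a u 0 a *: coord_vect i a x = u *m coord_frame i x :> 'rV[R]_m.
Proof. by rewrite mulmx_sum_row; apply: eq_bigr => a _; rewrite rowK. Qed.

Lemma coord_frame_span i x (X : 'rV[R]_m) : dom i x ->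
  X = \sum_a (X *m invmx (coord_frame i x)) 0 a *: coord_vect i a x.
Proof. by move=> /coord_frame_unit ux; rewrite coord_frame_sum mulmxKV. Qed.

Lemma gram_posdef i x : dom i x -> posdef (gram g i x).
Proof.
move=> /coord_frame_unit ux; apply: (inner_posdef (metric_inner g x)) => u.
by rewrite coord_frame_sum => /(congr1 (mulmx^~ (invmx (coord_frame i x)))); rewrite mulmxK // mul0mx.
Qed.

Lemma triv_inv_sum j x (u : 'rV[R]_n) :
  \sum_k u 0 k *: triv_inv j x (delta_mx 0 k) = triv_inv j x u.
Proof.
rewrite [in RHS](row_sum_delta u) linear_sum; apply: eq_bigr => k _.
by rewrite linearZ.
Qed.

Lemma fibre_gram_posdef j x : tdom j x -> posdef (fibre_gram j x).
Proof.
move=> jx; apply: (inner_posdef (fmetric_inner (fib E) x)) => u.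
by rewrite triv_inv_sum => /(congr1 (triv j x)); rewrite triv_invK // linear0.
Qed.

Lemma vertical_mxE s i j x (u w : 'rV[R]_m) : tdom j x ->
  fib E x (nabla E s x (u *m coord_frame i x)) (nabla E s x (w *m coord_frame i x)) =
  (u *m vertical_mx s i j x *m w^T) 0 0.
Proof.
move=> jx; have nE (v : 'rV[R]_m) : nabla E s x (v *m coord_frame i x) =
    \sum_k (v *m nabla_mx s i j x) 0 k *: triv_inv j x (delta_mx 0 k).
  rewrite triv_inv_sum -(trivK jx (nabla E s x _)); congr (triv_inv j x _).
  rewrite -coord_frame_sum !linear_sum mulmx_sum_row; apply: eq_bigr => a _.
  by rewrite !linearZ rowK.
by rewrite !nE (inner_gram (fmetric_inner (fib E) x)) /vertical_mx trmx_mul !mulmxA.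
Qed.

Lemma vertical_mx_sym s i j x : tdom j x -> (vertical_mx s i j x)^T = vertical_mx s i j x.
Proof.
by move=> /fibre_gram_posdef[Hs _]; rewrite /vertical_mx !trmx_mul trmxK Hs mulmxA.
Qed.

(** [alpha] is chosen by [xget], so a solution has to be exhibited: it is [vertical_mx] times the
    inverse of [gram], transported from the coordinate frame to the preferred chart. *)
Lemma alphaP s x (X Y : tangent x) :
  g x (alpha g s x X) Y = fib E x (nabla E s x X) (nabla E s x Y).
Proof.
rewrite /alpha; case: xgetP => [A _ -> //|/(_ _)].
have [j jx] := tdom_cover E x; have cx := chart_at_dom x.
set i := chart_at x in cx; have ux := coord_frame_unit cx.
pose A0 : 'M[R]_m := invmx (coord_frame i x) *m vertical_mx s i j x *m invmx (gram g i x)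
   *m coord_frame i x.
move=> /(_ (linfun (mulmxr A0) : 'End(tangent x))) []; move=> {}X {}Y.
rewrite lfunE /=.
pose u := X *m invmx (coord_frame i x); pose w := Y *m invmx (coord_frame i x).
have Xu : X = u *m coord_frame i x by rewrite mulmxKV.
have Yw : Y = w *m coord_frame i x by rewrite mulmxKV.
have Gu := posdef_unit (gram_posdef cx).
have -> : X *m A0 = (u *m vertical_mx s i j x *m invmx (gram g i x)) *m coord_frame i x.
  by rewrite /A0 !mulmxA.
rewrite [in LHS]Yw -!coord_frame_sum (inner_gram (metric_inner g x)) mulmxKV //.
by rewrite Xu Yw (vertical_mxE _ _ _ _ jx).
Qed.

(** In the coordinate frame, the defining equation of [alpha] says that its matrix times [gram] is
    [vertical_mx]. This makes the characteristic polynomial computable in any chart and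
    trivialisation. *)
Lemma alpha_conj s i j x : dom i x -> tdom j x ->
  lin1_mx (alpha g s x : 'rV[R]_m -> 'rV[R]_m) =
  invmx (coord_frame i x) *m (vertical_mx s i j x *m invmx (gram g i x)) *m coord_frame i x.
Proof.
move=> ix jx; have ux := coord_frame_unit ix; have Gu := posdef_unit (gram_posdef ix).
set A := lin1_mx _; set J := coord_frame i x in ux *.
suff e : J *m A *m invmx J *m gram g i x = vertical_mx s i j x.
  by rewrite -e mulmxK // !mulmxA mulVmx // mul1mx mulmxKV.
apply/matrixP => a c.
have Aw (u : 'rV[R]_m) : u *m A = alpha g s x u by rewrite mul_rV_lin1.
have := alphaP s (delta_mx 0 a *m J : tangent x) (delta_mx 0 c *m J : tangent x).
rewrite (vertical_mxE _ _ _ _ jx) -Aw.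
have -> : (delta_mx 0 a : 'rV[R]_m) *m J *m A = (delta_mx 0 a *m (J *m A *m invmx J)) *m J.
  by rewrite !mulmxA mulmxKV.
rewrite -!coord_frame_sum (inner_gram (metric_inner g x)).
by rewrite -[_ *m _ *m (\matrix_(_, _) _)]mulmxA !trmx_delta -!rowE -!colE !mxE.
Qed.

(** A splitting of the characteristic polynomial exists because the matrix is conjugate to a
    symmetric one, so [eigenvalues] is not the default of [xget]; any splitting gives the same
    symmetric functions, which are coefficients of that polynomial up to sign. *)
Lemma elem_sym_eigenvalues s i j x r : (r <= m)%N -> dom i x -> tdom j x ->
  elem_sym (eigenvalues g s x) r =
  sum_pminors (vertical_mx s i j x *m invmx (gram g i x)) r.
Proof.
move=> rm ix jx; have ux := coord_frame_unit ix.
have [l lP] := relative_char_poly_split (gram_posdef ix) (vertical_mx_sym s i jx).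
have cA : char_poly (lin1_mx (alpha g s x : 'rV[R]_m -> 'rV[R]_m)) =
    char_poly (vertical_mx s i j x *m invmx (gram g i x)).
  rewrite (alpha_conj _ ix jx) -[X in _ *m X](invmxK (coord_frame i x)) char_poly_conj //.
  by rewrite unitmx_inv.
apply: elem_sym_char_poly => //; rewrite -cA /eigenvalues.
case: xgetP => [t _ ->|/(_ [tuple l i | i < m]) []].
  by rewrite big_tuple.
change (char_poly (lin1_mx (alpha g s x : 'rV[R]_m -> 'rV[R]_m)) =
  \prod_(c <- [tuple l i | i < m]) ('X - c%:P)).
by rewrite cA lP big_tuple; apply: eq_bigr => a _; rewrite tnth_mktuple.
Qed.

Lemma rank_nabla_mx s i j x : dom i x -> tdom j x ->
  \rank (nabla_mx s i j x) = \dim (limg (nabla E s x)).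
Proof.
move=> ix jx; have -> : nabla_mx s i j x =
    \matrix_a (triv j x \o nabla E s x)%VF (coord_vect i a x).
  by apply/row_matrixP => a; rewrite !rowK comp_lfunE.
rewrite rank_limg; last first.
  by move=> X; exists (fun a => (X *m invmx (coord_frame i x)) 0 a); exact: coord_frame_span.
rewrite limg_comp limg_dim_eq //.
have /lker0P k0 : injective (triv j x) by exact: can_inj (trivK jx).
by rewrite (eqP k0) capv0.
Qed.

End VerticalTensor.

(** * Continuity, positivity and zeros of the energy density *)

Section VerticalContinuity.
Context (R : realType) (m : nat) (M : manifold R m) (g : riemannian_metric M)
  (n : nat) (E : riemannian_vector_bundle M n).
Local Notation dom := (@Defs.dom R m M).
Local Notation tdom := (@Defs.tdom R m M n E).
Implicit Types (s : forall x, E x) (x : M) (r i : nat) (j : tindex E).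

Lemma near_dom i x : dom i x -> \forall y \near x, dom i y.
Proof. by move=> ix; apply: open_nbhs_nbhs; split => //; exact: dom_open. Qed.

Lemma near_tdom j x : tdom j x -> \forall y \near x, tdom j y.
Proof. by move=> jx; apply: open_nbhs_nbhs; split => //; exact: tdom_open. Qed.

Lemma gram_continuous i x a c : dom i x -> {for x, continuous (fun y => gram g i y a c)}.
Proof.
move=> ix; rewrite (_ : (fun y => _) = fun y => g y (coord_vect i a y) (coord_vect i c y)).
  exact: smoothM_continuous (@dom_open R m M i) (metric_smooth g i a c) ix.
by apply/funext => y; rewrite mxE.
Qed.

Lemma gram_inv_continuous i x a c : dom i x -> {for x, continuous (fun y => invmx (gram g i y) a c)}.
Proof.
move=> ix; apply: continuous_at_invmx; last by move=> *; exact: gram_continuous.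
by apply: filterS (near_dom ix) => y iy; exact/posdef_unit/gram_posdef.
Qed.

Lemma fibre_gram_continuous j x k l : tdom j x -> {for x, continuous (fun y => fibre_gram j y k l)}.
Proof.
move=> jx; rewrite (_ : (fun y => _) =
  fun y => fib E y (triv_inv j y (delta_mx 0 k)) (triv_inv j y (delta_mx 0 l))).
  exact: smoothM_continuous (@tdom_open R m M n E j) (fmetric_smooth (fib E) j _ _) jx.
by apply/funext => y; rewrite mxE.
Qed.

(** Coordinate vectors do not form a global field, so continuity is read off the local formula of
    the connection. *)
Lemma nabla_mx_continuous s i j x a l : smooth_section s -> dom i x -> tdom j x ->
  {for x, continuous (fun y => nabla_mx s i j y a l)}.
Proof.
move=> ss ix jx.
have [U [G [oU Ux UO cG nE]]] := local_connection (nabla E) ix jx.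
have oj : open (tdom j) := @tdom_open R m M n E j.
have oO : open (dom i `&` tdom j) by apply: openI => //; exact: dom_open.
have sj : smoothM (dom i `&` tdom j) (fun y => triv j y (s y)).
  by apply: smoothM_sub (ss j) => y [].
apply: (near_eq_continuous (f := fun y =>
  ('D_(delta_mx 0 a : 'rV[R]_m) ((fun y => triv j y (s y)) \o Defs.chart_inv i) (Defs.chart i y)) 0 l
      + \sum_k (triv j y (s y)) 0 k * G a k y 0 l)).
  apply: filterS (open_nbhs_nbhs (conj oU Ux)) => y Uy.
  rewrite mxE nE // mxE summxE; congr (_ + _); apply: eq_bigr => k _.
  by rewrite mxE.
apply: continuousD.
  have sD := smoothM_derive (i := i) (delta_mx 0 a : 'rV[R]_m) oO (@subIsetl _ _ _) sj.
  exact: smoothM_continuous oO (smoothM_coord l oO sD) (conj ix jx).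
apply: continuous_at_sum => k; apply: continuousM.
  exact: smoothM_continuous oO (smoothM_coord k oO sj) (conj ix jx).
apply: (continuous_comp (f := G a k) (g := fun u : 'rV[R]_n => u 0 l)); first exact: cG.
exact: coord_continuous.
Qed.

(** The chosen eigenvalues may come in a discontinuous order, but their symmetric functions are
    polynomials in continuous matrix entries. *)
Lemma elem_sym_continuous s r x : (r <= m)%N -> smooth_section s ->
  {for x, continuous (fun y => elem_sym (eigenvalues g s y) r)}.
Proof.
move=> rm ss; have [i ix] := dom_cover x; have [j jx] := tdom_cover E x.
apply: (near_eq_continuous (f := fun y =>
  sum_pminors (vertical_mx s i j y *m invmx (gram g i y)) r)).
  by apply: filterS2 (near_dom ix) (near_tdom jx) => y iy jy; rewrite (elem_sym_eigenvalues g s rm iy jy).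
apply: continuous_at_sum_pminors; apply: continuous_at_mulmx; last first.
  by move=> *; exact: gram_inv_continuous.
apply: continuous_at_mulmx.
  by apply: continuous_at_mulmx => *; [exact: nabla_mx_continuous|exact: fibre_gram_continuous].
move=> k a; rewrite (_ : (fun y => _) = fun y => nabla_mx s i j y a k).
  exact: nabla_mx_continuous.
by apply/funext => y; rewrite mxE.
Qed.

Lemma elem_sym_ge0 s r x : (r <= m)%N -> 0 <= elem_sym (eigenvalues g s x) r.
Proof.
move=> rm; have [i ix] := dom_cover x; have [j jx] := tdom_cover E x.
rewrite (elem_sym_eigenvalues g s rm ix jx).
exact: relative_pminors_ge0 rm (gram_posdef g ix) (fibre_gram_posdef jx).
Qed.

Lemma elem_sym_eq0 s r x : (r <= m)%N ->
  (elem_sym (eigenvalues g s x) r == 0) = (\dim (limg (nabla E s x)) < r)%N.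
Proof.
move=> rm; have [i ix] := dom_cover x; have [j jx] := tdom_cover E x.
rewrite (elem_sym_eigenvalues g s rm ix jx) -(rank_nabla_mx s ix jx).
exact: relative_pminors_eq0 rm (gram_posdef g ix) (fibre_gram_posdef jx).
Qed.

End VerticalContinuity.

(** * The Riemannian volume of small sets and of relatively compact ones *)

Section Volume.
Context (R : realType) (m : nat) (M : manifold R m) (g : riemannian_metric M)
  (mu : riemannian_volume g).
Local Notation dom := (@Defs.dom R m M).
Local Notation chart := (@Defs.chart R m M).
Local Notation chart_inv := (@Defs.chart_inv R m M).
Implicit Types (O U : set M) (x : M).

Lemma open_measurable_borel U : open U -> measurable (U : set (borel M)).
Proof. by move=> oU; exact: sub_sigma_algebra. Qed.

(** The density sqrt (det g) is continuous and positive at x, so on a small coordinate cube it stays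
    between half its value at x and that value plus 1; the volume is then comparable with the
    Lebesgue measure of the cube. *)
Lemma vol_nbhs x O : open O -> O x -> exists U : set M,
  [/\ open U, U x, U `<=` O & (0 < mu U < +oo)%E].
Proof.
move=> oO Ox; have [i ix] := dom_cover x.
pose f y := Num.sqrt (\det (gram g i y)).
have cf : {for x, continuous f}.
  apply: (continuous_comp (f := fun y => \det (gram g i y)) (g := Num.sqrt)).
    by apply: continuous_at_det => a c; exact: gram_continuous.
  exact: sqrt_continuous.
have fx : 0 < f x by rewrite sqrtr_gt0; exact/posdef_det/gram_posdef.
have nf : \forall y \near x, f x / 2 < f y < f x + 1.
  apply: (cf [set z | f x / 2 < z < f x + 1]).
  have o : open [set z : R | f x / 2 < z < f x + 1].
    rewrite (_ : [set z : R | _] = [set z | f x / 2 < z] `&` [set z | z < f x + 1]).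
      by apply: openI; [exact: open_gt|exact: open_lt].
    by apply/seteqP; split => z /= => [/andP[]|[-> ->]].
  apply: open_nbhs_nbhs; split => //=.
  by rewrite ltrDl ltr01 andbT ltr_pdivrMr // mulrC ltr_pMl // ltr1n.
have [W [oW Wx] Wf] : exists2 W : set M, open W /\ W x & forall y, W y -> f x / 2 < f y < f x + 1.
  by have := nf; rewrite /prop_near1 nbhsE => -[W ? h]; exists W.
have oOW : open (O `&` W) by exact: openI.
have /nbhs_ballP[rho /= rho0 rhoP] := chart_image_nbhs oOW ix (conj Ox Wx).
pose U := dom i `&` chart i @^-1` ball (chart i x) rho.
have cU : chart i @` U = ball (chart i x) rho.
  apply/seteqP; split => [_ [y [iy by_] <-] //|y yb].
  have [iy _ e] := chart_image_inv (rhoP _ yb).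
  by exists (chart_inv i y) => //; split => //=; rewrite e.
have Uinv y : ball (chart i x) rho y -> (O `&` W) (chart_inv i y).
  by move=> /rhoP /chart_image_inv[].
have oU : open U.
  rewrite openE => y [iy yb]; rewrite /interior; apply: filterI; first exact: near_dom.
  apply: (chart_continuous iy); apply: open_nbhs_nbhs; split => //.
  exact: ball_open.
exists U; split => //.
- by split => //; exact: ballxx.
- by move=> y [iy /Uinv]; rewrite chartK // => -[].
have Ui : U `<=` dom i by move=> y [].
rewrite (volE mu (open_measurable_borel oU) Ui).
rewrite cU; set I := integral_rV _.
have fb y : (f x / 2 * \1_(ball (chart i x) rho) y <=
    \1_(ball (chart i x) rho) y * f (chart_inv i y)) &&
  (\1_(ball (chart i x) rho) y * f (chart_inv i y) <= (f x + 1) * \1_(ball (chart i x) rho) y).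
  rewrite indicE; case: (boolP (y \in _)) => [/set_mem/Uinv[_ /Wf/andP[l u]]|_].
    by rewrite !mulr1 !mul1r !ltW.
  by rewrite !mulr0 mul0r lexx.
have fx2 : 0 < f x / 2 by rewrite divr_gt0.
have p0 (k : R) : 0 < k -> 0 < k * (2 * rho) ^+ m.
  by move=> k0; rewrite mulr_gt0 // exprn_gt0 // mulr_gt0.
apply/andP; split.
  apply: (@lt_le_trans _ _ (f x / 2 * (2 * rho) ^+ m)%:E); first by rewrite lte_fin p0.
  rewrite -(integral_rV_ball (chart i x) rho0 (ltW fx2)); apply: integral_rV_mono => y.
    by rewrite lee_fin indicE; apply: mulr_ge0; [exact: ltW|exact: ler0n].
  by rewrite lee_fin; case/andP: (fb y).
apply: (@le_lt_trans _ _ ((f x + 1) * (2 * rho) ^+ m)%:E); last exact: ltry.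
have fx1 : 0 <= f x + 1 by rewrite addr_ge0 // ltW.
rewrite -(integral_rV_ball (chart i x) rho0 fx1); apply: integral_rV_mono => y.
  by rewrite lee_fin mulr_ge0 // sqrtr_ge0.
by rewrite lee_fin; case/andP: (fb y).
Qed.

Lemma vol_compact (D : set M) : open D -> compact (closure D) -> (mu D < +oo)%E.
Proof.
move=> oD cD.
have [Q [mQ Qoo] DQ] : exists2 Q : set (borel M), measurable Q /\ (mu Q < +oo)%E & closure D `<=` Q.
  apply: (compact_subset_union (P := fun Q : set M => measurable (Q : set (borel M)) /\ (mu Q < +oo)%E)) cD.
  - by split => //; rewrite measure0.
  - move=> A B [mA fA] [mB fB]; split; first exact: measurableU.
    by apply: le_lt_trans (measureU2 mu mA mB) _; exact: lte_add_pinfty.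
  - move=> x _; have [U [oU Ux _ /andP[_ Uf]]] := vol_nbhs openT (I : setT x).
    by exists U; [exact: open_nbhs_nbhs|split => //; exact: open_measurable_borel].
apply: le_lt_trans Qoo; apply: le_measure; rewrite ?inE //.
  exact: open_measurable_borel.
by apply: subset_trans DQ; exact: subset_closure.
Qed.

End Volume.

(** * Functions of time and coordinates *)

Section TimeDependent.
Context {R : realType}.

Let differentiable_id (V : normedModType R) (x : V) : differentiable (id : V -> V) x.
Proof. by []. Qed.

Let diff_id (V : normedModType R) (x : V) : 'd (id : V -> V) x = id :> (V -> V).
Proof. exact: diff_val. Qed.

Lemma differentiable_slice_l m (y : 'rV[R]_m) (t : R) : differentiable (fun t : R => (t, y)) t.
Proof. by apply: differentiable_pair; [exact: differentiable_id|exact: differentiable_cst]. Qed.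

Lemma differentiable_slice_r m (t : R) (y : 'rV[R]_m) : differentiable (fun y => (t, y)) y.
Proof. by apply: differentiable_pair; [exact: differentiable_cst|exact: differentiable_id]. Qed.

Lemma derive_slice_id m (t : R) (y v : 'rV[R]_m) : 'D_v (fun y => (t, y)) y = (0, v).
Proof.
rewrite (deriveE _ (differentiable_slice_r t y)).
have /= -> := congr1 (fun h : 'rV[R]_m -> R * 'rV[R]_m => h v)
  (diff_pair (differentiable_cst t y) (differentiable_id y)).
by rewrite diff_cst diff_id.
Qed.

Lemma derive_slice_l m (W : normedModType R) (F : R * 'rV[R]_m -> W) (t : R) (y : 'rV[R]_m) :
  differentiable F (t, y) ->
  'D_(1 : R) (F \o (fun t : R => (t, y))) t = 'D_((1, 0) : R * 'rV[R]_m) F (t, y).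
Proof.
move=> dF; rewrite (derive_comp (1 : R) (differentiable_slice_l y t) dF); congr (derive _ _ _).
rewrite (deriveE _ (differentiable_slice_l y t)).
have /= -> := congr1 (fun h : R -> R * 'rV[R]_m => h 1)
  (diff_pair (differentiable_id t) (differentiable_cst y t)).
by rewrite diff_cst diff_id.
Qed.

Lemma derive_slice_r m (W : normedModType R) (F : R * 'rV[R]_m -> W) (t : R) (y v : 'rV[R]_m) :
  differentiable F (t, y) ->
  'D_v (F \o (fun y => (t, y))) y = 'D_((0, v) : R * 'rV[R]_m) F (t, y).
Proof.
move=> dF; rewrite (derive_comp v (differentiable_slice_r t y) dF); congr (derive _ _ _).
exact: derive_slice_id.
Qed.

(** Mean value theorem between 0 and t, the time derivative being bounded near (0, y0) by
    continuity. *)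
Lemma lipschitz_in_time m (A : set (R * 'rV[R]_m)) (F : R * 'rV[R]_m -> R) (y0 : 'rV[R]_m) :
  open A -> A (0, y0) -> is_Ck 1 A F -> exists2 C, 0 <= C & exists2 e, 0 < e &
  forall t y, `|t| < e -> ball y0 e y -> `|F (t, y) - F (0, y)| <= C * `|t|.
Proof.
move=> oA A0 [dF cF]; pose G := 'D_((1, 0) : R * 'rV[R]_m) F.
have cG : {for (0, y0), continuous G} by exact: cF.
pose C := `|G (0, y0)| + 1; have C0 : 0 <= C by rewrite addr_ge0.
have n1 : \forall p \near (0 : R, y0), `|G p| < C.
  have cN : {for (0 : R, y0), continuous (fun p => `|G p|)}.
    apply: (continuous_comp (f := G) (g := fun z : R => `|z|)); first exact: cG.
    exact: norm_continuous.
  by apply: (cN [set z | z < C]); apply: lt_nbhsl; rewrite ltrDl.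
have n2 : \forall p \near (0 : R, y0), A p by exact: open_nbhs_nbhs.
have [e /= e0 eP] : exists2 e : R, 0 < e & forall p, ball (0 : R, y0) e p -> `|G p| < C /\ A p.
  have /nbhs_ballP[e e0 eP] : nbhs (0 : R, y0) [set p | `|G p| < C /\ A p] by exact: filterI.
  by exists e => // p /eP.
exists C => //; exists e => // t y te ye.
have inA tau : `|tau| < e -> `|G (tau, y)| < C /\ A (tau, y).
  by move=> taue; apply: eP; split => //=; rewrite /ball /= sub0r normrN.
pose h := F \o (fun t : R => (t, y)).
have dh tau : `|tau| < e -> is_derive tau (1 : R) h (G (tau, y)).
  move=> /inA[_ /dF dFt]; apply: DeriveDef; last exact: derive_slice_l.
  apply: diff_derivable.
  exact: differentiable_comp (differentiable_slice_l y tau) dFt.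
have main a b : a <= b -> `|a| < e -> `|b| < e -> `|h b - h a| <= C * (b - a).
  move=> ab ae be; have itv tau : tau \in `[a, b] -> `|tau| < e.
    rewrite in_itv /= => /andP[l u]; rewrite ltr_norml.
    move: ae be; rewrite !ltr_norml => /andP[ea _] /andP[_ eb].
    by rewrite (lt_le_trans ea l) (le_lt_trans u eb).
  have [||c cab ->] := @MVT_segment R h (fun tau => G (tau, y)) a b ab.
  - by move=> tau tab; apply: dh; apply: itv; apply: subset_itv_oo_cc tab.
  - by apply: derivable_within_continuous => tau /itv /dh[].
  - rewrite normrM [`|b - a|]ger0_norm ?subr_ge0 // ler_wpM2r ?subr_ge0 //.
    by have [/ltW] := inA c (itv c cab).
have z0 : `|0 : R| < e by rewrite normr0.
have [t0|t0] := leP 0 t.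
  by have := main 0 t t0 z0 te; rewrite subr0 [`|t|]ger0_norm.
by have := main t 0 (ltW t0) te z0; rewrite sub0r distrC [`|t|]ltr0_norm.
Qed.

Lemma finite_uniform (I : finType) (P : I -> R -> R -> Prop) :
  (forall i C C' e e', C <= C' -> e' <= e -> P i C e -> P i C' e') ->
  (forall i, exists2 C, 0 <= C & exists2 e, 0 < e & P i C e) ->
  exists2 C, 0 <= C & exists2 e, 0 < e & forall i, P i C e.
Proof.
move=> mono h.
suff [C C0 [e e0 Ce]] : exists2 C, 0 <= C & exists2 e, 0 < e & forall i, i \in enum I -> P i C e.
  by exists C => //; exists e => // i; apply: Ce; rewrite mem_enum.
elim: (enum I) => [|a r [C C0 [e e0 Ce]]]; first by exists 0 => //; exists 1.
have [C' C'0 [e' e'0 Ce']] := h a; exists (C + C'); first exact: addr_ge0.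
exists (Num.min e e'); first by rewrite lt_min e0.
move=> i; rewrite inE => /orP[/eqP -> | /Ce].
  by apply: mono Ce'; rewrite ?lerDr // ge_min lexx orbT.
by apply: mono; rewrite ?lerDl // ge_min lexx.
Qed.

Lemma lipschitz_in_time_rV m n (A : set (R * 'rV[R]_m)) (I : finType)
    (F : I -> R * 'rV[R]_m -> 'rV[R]_n) (y0 : 'rV[R]_m) :
  open A -> A (0, y0) -> (forall a, is_Ck 1 A (F a)) -> exists2 C, 0 <= C & exists2 e, 0 < e &
  forall a l t y, `|t| < e -> ball y0 e y -> `|F a (t, y) 0 l - F a (0, y) 0 l| <= C * `|t|.
Proof.
move=> oA A0 sF.
have [||C C0 [e e0 H]] := @finite_uniform (I * 'I_n)%type (fun al C e => forall t y, `|t| < e -> ball y0 e y ->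
    `|F al.1 (t, y) 0 al.2 - F al.1 (0, y) 0 al.2| <= C * `|t|).
- move=> al C C' e e' CC ee H t y te ye.
  apply: le_trans (H t y (lt_le_trans te ee) (le_ball ee ye)) _.
  by rewrite ler_wpM2r.
- move=> [a l] /=; apply: (lipschitz_in_time (F := fun p => F a p 0 l) oA A0).
  exact: (is_Ck_comp_rV oA (fun _ _ => Logic.I) (sF a) (is_Ck_coord 1 setT l)).
by exists C => //; exists e => // a l; exact: (H (a, l)).
Qed.

End TimeDependent.

(** * The energy density along a variation of a parallel section *)

Section QuadraticBound.
Context (R : realType) (m : nat) (M : manifold R m) (g : riemannian_metric M)
  (n : nat) (E : riemannian_vector_bundle M n).
Local Notation dom := (@Defs.dom R m M).
Local Notation chart := (@Defs.chart R m M).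
Local Notation chart_inv := (@Defs.chart_inv R m M).
Local Notation tdom := (@Defs.tdom R m M n E).
Implicit Types (s : forall x, E x) (x : M) (r i : nat) (j : tindex E).
Context (S : R -> forall x, E x) (delta : R).

Definition time_domain i j : set (R * 'rV[R]_m) :=
  [set p | `|p.1| < delta /\ (chart i @` (dom i `&` tdom j)) p.2].

Definition local_rep i j (p : R * 'rV[R]_m) : 'rV[R]_n :=
  triv j (chart_inv i p.2) (S p.1 (chart_inv i p.2)).

Context (delta0 : 0 < delta)
  (S_smooth : forall i j, smooth_on (time_domain i j) (local_rep i j)).

Lemma time_domain_open i j : open (time_domain i j).
Proof.
have -> : time_domain i j = [set p | `|p.1| < delta] `&`
    [set p | (chart i @` (dom i `&` tdom j)) p.2] by [].
apply: openI.
  apply: (open_comp (f := fun p : R * 'rV[R]_m => `|p.1|) (D := [set z : R | z < delta])).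
    move=> p _; apply: (continuous_comp (f := fst) (g := fun z : R => `|z|)); first exact: cvg_fst.
    exact: norm_continuous.
  exact: open_lt.
apply: (open_comp (f := snd) (D := chart i @` (dom i `&` tdom j))).
  by move=> p _; exact: cvg_snd.
by apply: chart_image_open; exact: tdom_open.
Qed.

Lemma variation_section_smooth t : `|t| < delta -> smooth_section (S t).
Proof.
move=> td j i k.
have oA : open (chart i @` (dom i `&` tdom j)) by apply: chart_image_open; exact: tdom_open.
have sg : is_Ck k (chart i @` (dom i `&` tdom j)) (fun y : 'rV[R]_m => (t, y)).
  case: k => [|k] /=; first by move=> y _; exact/differentiable_continuous/differentiable_slice_r.
  split => [y _|v]; first exact: differentiable_slice_r.
  rewrite (_ : 'D_v _ = cst (0, v)); first exact: is_Ck_cst.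
  by apply/funext => y; exact: derive_slice_id.
have AB y : (chart i @` (dom i `&` tdom j)) y -> time_domain i j (t, y) by [].
exact: (is_Ck_comp_RrV oA AB sg (@S_smooth i j k)).
Qed.

(** In a local frame, nabla of S t is nabla of S 0 plus t N1 with N1 bounded near x0. The inverse
    metric on M, the fibre metric and nabla of S 0 are bounded there by continuity, so
    [relative_pminors_quadratic] gives one constant for all x in U. *)
Lemma variation_quadratic_bound r x0 : (r <= m)%N ->
  (forall x, (\dim (limg (nabla E (S 0) x)) < r)%N) ->
  exists2 U, nbhs x0 U & exists2 C, 0 <= C & exists2 e, 0 < e &
  forall t x, `|t| < e -> U x -> elem_sym (eigenvalues g (S t) x) r <= C * t ^+ 2.
Proof.
move=> rm par; have [i ix0] := dom_cover x0; have [j jx0] := tdom_cover E x0.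
have [U [G [oU Ux0 UO cG nE]]] := local_connection (nabla E) ix0 jx0.
have oA := @time_domain_open i j.
have A0 : time_domain i j (0, chart i x0).
  by split => /=; [rewrite normr0|exists x0].
pose L := local_rep i j.
have [C1 C10 [e1 e10 H1]] := lipschitz_in_time_rV (I := unit) (F := fun=> L) oA A0
  (fun=> @S_smooth i j 1%N).
(* The local formula for nabla contains first space derivatives of the local representative; they
   are Lipschitz in t because the representative is C^2. *)
have [C2 C20 [e2 e20 H2]] := lipschitz_in_time_rV (I := 'I_m)
  (F := fun a => 'D_((0, delta_mx 0 a) : R * 'rV[R]_m) L) oA A0
  (fun a => (@S_smooth i j 2%N).2 (0, delta_mx 0 a)).
have [CG CG0 bG] : exists2 C, 0 <= C & \forall y \near x0, forall a k l, `|G a k y 0 l| <= C.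
  have [|C C0 bC] := @bounded_near_mx _ _ x0 _ _ (fun y => \matrix_(a, k) \sum_l `|G a k y 0 l|).
    move=> a k; rewrite (_ : (fun y => _) = fun y => \sum_l `|G a k y 0 l|); last first.
      by apply/funext => y; rewrite mxE.
    apply: continuous_at_sum => l.
    apply: (continuous_comp (f := G a k) (g := fun u : 'rV[R]_n => `|u 0 l|)); first exact: cG.
    apply: (continuous_comp (f := fun u : 'rV[R]_n => u 0 l) (g := fun z : R => `|z|)).
      exact: coord_continuous.
    exact: norm_continuous.
  exists C => //; apply: filterS bC => y bC a k l; apply: le_trans (bC a k).
  rewrite mxE [leRHS]ger0_norm ?sumr_ge0 // (bigD1 l) //= lerDl.
  by apply: sumr_ge0.
have [CI CI0 bI] := bounded_near_mx (fun a c => @gram_inv_continuous R m M g i x0 a c ix0).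
have [CH CH0 bH] := bounded_near_mx (fun a c => @fibre_gram_continuous R m M n E j x0 a c jx0).
have sS0 : smooth_section (S 0) by apply: variation_section_smooth; rewrite normr0.
have [CN CN0 bN] := bounded_near_mx (fun a c => @nabla_mx_continuous R m M n E (S 0) i j x0 a c sS0 ix0 jx0).
(* Lipschitz constant in t of the entries of [nabla_mx]: the derivative term, and n connection terms
   with coefficients bounded by CG. *)
pose C3 := C2 + \sum_(k < n) C1 * CG.
have C30 : 0 <= C3 by rewrite addr_ge0 // sumr_ge0 // => k _; rewrite mulr_ge0.
pose b := C3 + CI + CH + CN.
have [b0 C3b [CIb CHb CNb]] : [/\ 0 <= b, C3 <= b & [/\ CI <= b, CH <= b & CN <= b]].
  by rewrite /b; clear b; clearbody C3; split; [lra|lra|split; lra].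
have [C C0 CP] := relative_pminors_quadratic n b0 rm.
pose e := Num.min (Num.min e1 e2) (Num.min delta 1).
have e0 : 0 < e by rewrite !lt_min e10 e20 delta0 ltr01.
have nb : \forall x \near x0, ball (chart i x0) e (chart i x).
  by apply: (chart_continuous ix0); exact: nbhsx_ballx.
exists [set x | [/\ U x, ball (chart i x0) e (chart i x), forall a k l, `|G a k x 0 l| <= CG &
    [/\ forall a c, `|invmx (gram g i x) a c| <= CI,
        forall k l, `|@fibre_gram _ _ _ _ E j x k l| <= CH &
        forall a l, `|nabla_mx (S 0) i j x a l| <= CN]]].
  near=> x; split; [|by near: x|by near: x|split; by near: x].
  by near: x; exact: open_nbhs_nbhs.
exists C => //; exists e => // t x te [Ux bx bGx [bIx bHx bNx]].
have [ix jx] := UO _ Ux.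
rewrite /e !lt_min -!andbA in te; case/and4P: te => te1 te2 td t1.
have sSt : smooth_section (S t) by exact: variation_section_smooth.
have be1 : ball (chart i x0) e1 (chart i x).
  by apply: le_ball bx; rewrite /e !ge_min lexx.
have be2 : ball (chart i x0) e2 (chart i x).
  by apply: le_ball bx; rewrite /e !ge_min lexx orbT.
have NE (tau : R) : `|tau| < delta -> forall a l, nabla_mx (S tau) i j x a l =
  ('D_((0, delta_mx 0 a) : R * 'rV[R]_m) L (tau, chart i x)) 0 l +
  \sum_k L (tau, chart i x) 0 k * G a k x 0 l.
  move=> taud a l; rewrite mxE (nE _ (variation_section_smooth taud) _ Ux) mxE summxE.
  have dL : differentiable L (tau, chart i x).
    by apply: smooth_on_differentiable (@S_smooth i j) _; split => //; exists x.
  rewrite -(derive_slice_r (delta_mx 0 a) dL); congr (_ + _).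
  by apply: eq_bigr => k _; rewrite mxE /L /local_rep /= chartK.
(* At t = 0 the convention 0^-1 = 0 gives N1 = 0, and the decomposition below still holds. *)
pose N1 := t^-1 *: (nabla_mx (S t) i j x - nabla_mx (S 0) i j x).
have NtE : nabla_mx (S t) i j x = nabla_mx (S 0) i j x + t *: N1.
  have [->|tn0] := eqVneq t 0; first by rewrite scale0r addr0.
  by rewrite /N1 scalerA divff // scale1r addrC subrK.
have dN a l : `|nabla_mx (S t) i j x a l - nabla_mx (S 0) i j x a l| <= C3 * `|t|.
  rewrite (NE t td) (NE 0) ?normr0 // opprD addrACA -sumrB mulrDl mulr_suml.
  apply: le_trans (ler_normD _ _) _; rewrite lerD //; first exact: H2.
  apply: le_trans (ler_norm_sum _ _ _) _; apply: ler_sum => k _.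
  by rewrite -mulrBl normrM mulrAC ler_pM // (H1 tt).
rewrite (elem_sym_eigenvalues g (S t) rm ix jx) /vertical_mx NtE.
apply: CP; [exact: gram_posdef|exact: fibre_gram_posdef| | | | |exact: ltW|].
- by move=> a c; exact: le_trans (bIx a c) CIb.
- by move=> a c; exact: le_trans (bHx a c) CHb.
- by move=> a c; exact: le_trans (bNx a c) CNb.
- move=> a c; apply: le_trans C3b.
  rewrite !mxE normrM normfV.
  have [->|tn0] := eqVneq t 0; first by rewrite normr0 invr0 mul0r.
  rewrite ler_pdivrMl ?normr_gt0 // [leRHS]mulrC.
  by move: (dN a c); rewrite !mxE.
- by rewrite rank_nabla_mx.
Unshelve. all: by end_near. Qed.

End QuadraticBound.

(** * Harmonic sections *)

Lemma fine_leD (R : realType) (a u b : \bar R) (h t c : R) : 0 <= h ->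
  a \is a fin_num -> u \is a fin_num -> b \is a fin_num ->
  (a + (t * c)%:E * u <= b)%E -> h * fine a + t * (h * (c * fine u)) <= h * fine b.
Proof.
move=> h0; move: a u b => [a| |] [u| |] [b| |] //= _ _ _; rewrite -EFinM -EFinD lee_fin => le.
by rewrite [t * _]mulrCA -mulrDr ler_wpM2l // mulrA.
Qed.

(** The difference quotients from the right at 0 are at least k, so they cannot tend to 0. *)
Lemma linear_growth_not_stationary (R : realType) (F : R -> R) (k : R) : 0 < k ->
  (forall t, 0 <= t -> t * k <= F t - F 0) -> ~ is_derive (0 : R) (1 : R) F 0.
Proof.
move=> k0 Ft [dF vF].
have cF : (fun h : R => h^-1 *: ((F \o shift 0) (h *: 1) - F 0)) @ 0^' --> (0 : R).
  have : (fun h : R => h^-1 *: ((F \o shift 0) (h *: 1) - F 0)) @ 0^' --> 'D_1 F 0 by exact: dF.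
  by rewrite vF.
have /cvgr0Pnorm_lt/(_ _ k0) := cF.
move=> /nbhs_ballP[d /= d0 dP].
have d20 : 0 < d / 2 by rewrite divr_gt0.
have := dP (d / 2); rewrite /ball /= sub0r normrN gtr0_norm //.
rewrite ltr_pdivrMr // ltr_pMr // ltr1n => /(_ isT); rewrite gt_eqF // => /(_ isT).
rewrite addr0 [_ *: 1]mulr1 ltNge => /negP; apply.
apply: le_trans (ler_norm _); rewrite [_ *: _]mulrC ler_pdivlMr // mulrC.
exact/Ft/ltW.
Qed.

Section Harmonic.
Context (R : realType) (m : nat) (M : manifold R m) (g : riemannian_metric M)
  (mu : riemannian_volume g) (n : nat) (E : riemannian_vector_bundle M n).
Local Notation dom := (@Defs.dom R m M).
Local Notation chart := (@Defs.chart R m M).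
Local Notation chart_inv := (@Defs.chart_inv R m M).
Local Notation tdom := (@Defs.tdom R m M n E).
Implicit Types (s : forall x, E x) (x : M) (r i : nat) (j : tindex E) (D : set M).

(** The energy applies [fine] to an extended integral, which would send +oo to 0; a bounded
    integrand on a set of finite volume excludes this. *)
Lemma Rintegral_bound D (f : M -> R) (c : R) : open D -> compact (closure D) ->
  (forall x, D x -> 0 <= f x <= c) ->
  [/\ (\int[mu]_(x in (D : set (borel M))) (f x)%:E)%E \is a fin_num,
      0 <= (\int[mu]_(x in (D : set (borel M))) f x)%R
    & (\int[mu]_(x in (D : set (borel M))) f x)%R <= c * fine (mu D)].
Proof.
move=> oD cD fc; have mD := open_measurable_borel oD.
have finD : mu D \is a fin_num by rewrite ge0_fin_numE //; exact: vol_compact.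
set I := integral mu (D : set (borel M)) _.
have I0 : (0 <= I)%E.
  by apply: integral_ge0 => x Dx; rewrite lee_fin; case/andP: (fc x Dx).
have Ic : (I <= (c * fine (mu D))%:E)%E.
  rewrite EFinM fineK // -(integral_cst mu mD).
  apply: ge0_integral_mono => x Dx; rewrite lee_fin; by case/andP: (fc x Dx).
have finI : I \is a fin_num by rewrite ge0_fin_numE // (le_lt_trans Ic) // ltry.
split => //; first by rewrite /Rintegral fine_ge0.
by rewrite -lee_fin /Rintegral fineK.
Qed.

Lemma parallel_harmonic r s : (r <= m)%N -> r_parallel r s -> r_harmonic mu r s.
Proof.
move=> rm par D oD cD S [delta [delta0 Ssm S0 _]].
have eS : S 0 = s by apply: functional_extensionality_dep.
have par0 x : (\dim (limg (nabla E (S 0%R) x)) < r)%N by rewrite eS.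
(* The local constants C and e are merged by sum and minimum over finitely many neighbourhoods,
   which suffice for the compact closure of D. *)
have [Q [C C0 [e e0 CP]] DQ] : exists2 Q : set M, (exists2 C, 0 <= C & exists2 e, 0 < e &
    forall t x, `|t| < e -> Q x -> elem_sym (eigenvalues g (S t) x) r <= C * t ^+ 2) &
    closure D `<=` Q.
  apply: (compact_subset_union (P := fun Q : set M => exists2 C, 0 <= C & exists2 e, 0 < e &
    forall t x, `|t| < e -> Q x -> elem_sym (eigenvalues g (S t) x) r <= C * t ^+ 2)) cD.
  - by exists 0 => //; exists 1.
  - move=> A B [C C0 [e e0 H]] [C' C'0 [e' e'0 H']]; exists (C + C'); first exact: addr_ge0.
    exists (Num.min e e'); first by rewrite lt_min e0.
    move=> t x; rewrite lt_min => /andP[te te'] [Ax|Bx].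
      by apply: le_trans (H t x te Ax) _; rewrite ler_wpM2r ?sqr_ge0 // lerDl.
    by apply: le_trans (H' t x te' Bx) _; rewrite ler_wpM2r ?sqr_ge0 // lerDr.
  - by move=> x _; apply: (variation_quadratic_bound g delta0 Ssm).
have D0 : 0 <= fine (mu D) by rewrite fine_ge0.
apply: (is_derive_quadratic (C := 2^-1 * (C * fine (mu D)))) e0 _.
  by rewrite mulr_ge0 // mulr_ge0.
move=> t te; have bt x : D x -> 0 <= elem_sym (eigenvalues g (S t) x) r <= C * t ^+ 2.
  by move=> Dx; rewrite elem_sym_ge0 //= CP //; apply: DQ; exact: subset_closure.
have [_ I0 Ic] := Rintegral_bound oD cD bt.
rewrite /vertical_energy ger0_norm; last by rewrite mulr_ge0.
by rewrite -mulrA ler_wpM2l // mulrAC.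
Qed.

(** As the metric is parallel, differentiating the constant <s, s> gives 2 <nabla s, s> = 0. *)
Lemma constant_length_inner s : smooth_section s -> constant_length s ->
  forall x (X : tangent x), fib E x (nabla E s x X) (s x) = 0.
Proof.
move=> ss [c sc] x X; have := fib_parallel ss ss X.
have -> : (fun y => fib E y (s y) (s y)) = (fun=> c ^+ 2).
  by apply/funext => y; rewrite -(sc y) sqr_sqrtr // (inner_ge0 (fmetric_inner (fib E) y)).
rewrite dfun_cst; have [_ bs _] := fmetric_inner (fib E) x.
rewrite [fib E x (s x) _]bs -mulr2n => /esym/eqP; rewrite mulrn_eq0 /=.
by move/eqP.
Qed.

Lemma parallel_ge_rank r s : smooth_section s -> constant_length s ->
  (0 < r)%N -> (n <= r)%N -> r_parallel r s.
Proof.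
move=> ss sc r0 nr x; have [j jx] := tdom_cover E x.
have dE : (\dim {:E x} <= n)%N.
  have /lker0P k0 : injective (triv j x) by exact: can_inj (trivK jx).
  rewrite -(@limg_dim_eq _ _ _ (triv j x)); last by rewrite (eqP k0) capv0.
  apply: leq_trans (dimvS (subvf _)) _.
  by rewrite dimvf /dim /= mul1n.
(* If s vanishes at one point it vanishes everywhere by constant length, and rank 0 is less than r
   because r > 0. Otherwise s x is not in the image of nabla s, being nonzero and orthogonal to
   it. *)
have [s0|s0] := eqVneq (s x) 0.
  have [c cP] := sc; have c0 : c = 0.
    by rewrite -(cP x) s0 (inner0l (fmetric_inner (fib E) x)) sqrtr0.
  have sz : s = (fun y => 0).
    apply: functional_extensionality_dep => y; apply: contrapT => /eqP sy.
    have [_ _ p] := fmetric_inner (fib E) y.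
    by have := p _ sy; rewrite -sqrtr_gt0 cP c0 ltxx.
  by rewrite sz conn0 lim0g dimv0.
apply: leq_trans nr; apply: leq_trans dE; rewrite ltnNge; apply/negP => full.
have : s x \in limg (nabla E s x).
  have /eqP -> : limg (nabla E s x) == fullv by rewrite eqEdim subvf.
  exact: memvf.
case/memv_imgP => X _ sX.
have e : fib E x (s x) (s x) = 0.
  by rewrite [X in fib E x X _]sX; exact: constant_length_inner.
by have [_ _ p] := fmetric_inner (fib E) x; have := p _ s0; rewrite e ltxx.
Qed.

Section RadialVariation.
Context (s : forall x, E x) (f : M -> R).
Context (ss : smooth_section s) (sc : constant_length s) (sf : smoothM setT f).

Definition radial (t : R) x : E x := (1 + t * f x) *: s x.

Lemma smooth_factor t : smoothM setT (fun x => 1 + t * f x).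
Proof.
have oT : open [set: M] by exact: openT.
by apply: smoothM_add => //; [exact: smoothM_cst|apply: smoothM_mul => //; exact: smoothM_cst].
Qed.

Lemma radial_smooth t : smooth_section (radial t).
Proof. exact: smooth_section_scale (smooth_factor t) ss. Qed.

Lemma radial_variation D K : compact K -> K `<=` D -> (forall x, ~ K x -> f x = 0) ->
  variation s D radial.
Proof.
move=> cK KD fK; exists 1; split => //; last 2 first.
- by move=> x; rewrite /radial mul0r addr0 scale1r.
- by exists K; split => // t x _ /fK fx; rewrite /radial fx mulr0 addr0 scale1r.
move=> i j k.
pose A := chart i @` (dom i `&` tdom j).
pose Om := [set p : R * 'rV[R]_m | `|p.1| < 1 /\ A p.2].
have oOm : open Om by exact: (@time_domain_open _ _ _ _ E 1 i j).
have s1 : is_Ck k Om (fun p : R * 'rV[R]_m => p.1).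
  pose l : {linear (R * 'rV[R]_m)%type -> R} := fst.
  by apply: (@is_Ck_lin R _ _ k Om l) => p; exact: cvg_fst.
have s2 : is_Ck k Om (fun p : R * 'rV[R]_m => p.2).
  pose l : {linear (R * 'rV[R]_m)%type -> 'rV[R]_m} := snd.
  by apply: (@is_Ck_lin R _ _ k Om l) => p; exact: cvg_snd.
have AP p : Om p -> A p.2 by case.
have sF : is_Ck k Om ((f \o chart_inv i) \o (fun p : R * 'rV[R]_m => p.2)).
  exact: is_Ck_comp_rV oOm AP s2 (smoothM_sub (@subsetT _ _) sf i k).
have sL : is_Ck k Om (((fun y => triv j y (s y)) \o chart_inv i) \o (fun p : R * 'rV[R]_m => p.2)).
  exact: is_Ck_comp_rV oOm AP s2 (ss j i k).
have := is_Ck_scale oOm (is_Ck_add oOm (is_Ck_cst k Om (1 : R)) (is_Ck_mul oOm s1 sF)) sL.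
apply: is_Ck_eq => // p _; rewrite /radial linearZ //.
Qed.

Lemma vertical_mx_entry (u : forall x, E x) i j x a c : tdom j x ->
  vertical_mx u i j x a c =
  fib E x (nabla E u x (coord_vect i a x)) (nabla E u x (coord_vect i c x)).
Proof.
move=> jx; have := vertical_mxE u i (delta_mx 0 a) (delta_mx 0 c) jx.
by rewrite -!rowE !rowK trmx_delta -colE !mxE => ->.
Qed.

Lemma radial_vertical_mx t i j x : tdom j x ->
  exists w : 'cV[R]_m, vertical_mx (radial t) i j x =
    (1 + t * f x) ^+ 2 *: vertical_mx s i j x + w *m w^T.
Proof.
move=> jx; pose df a := dfun (fun y => 1 + t * f y) (coord_vect i a x).
(* By the Leibniz rule, nabla of the radial section is d(1 + t f) times s plus (1 + t f) nabla s.
   The first term contributes |s|^2 times the square of d(1 + t f), whence the factor |s| in w; the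
   mixed terms vanish by orthogonality. *)
exists (\col_a (Num.sqrt (fib E x (s x) (s x)) * df a)).
apply/matrixP => a c; rewrite [RHS]mxE [X in _ = X + _]mxE !(vertical_mx_entry _ _ _ _ jx).
have nE b : nabla E (radial t) x (coord_vect i b x) =
    df b *: s x + (1 + t * f x) *: nabla E s x (coord_vect i b x).
  exact: (conn_leibniz (nabla E) (smooth_factor t) ss (coord_vect i b x)).
have hb := fmetric_inner (fib E) x.
have orth (X : tangent x) := constant_length_inner ss sc X.
rewrite !nE (inner_expand_orthogonal hb) ?orth // addrC mxE big_ord1 !mxE.
congr (_ + _); move: (inner_ge0 hb (s x)) (df a) (df c).
move: (fib E x (s x) (s x)) => q q0 da dc.
by rewrite [RHS]mulrACA -expr2 sqr_sqrtr // mulrC.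
Qed.

(** The sum of principal r-minors is homogeneous of degree r, and [vertical_mx] is scaled by (1 + t
    f)^2, whence the exponent 2r; the rank one term is dropped by monotonicity. *)
Lemma radial_elem_sym_le t r x : (r <= m)%N ->
  (1 + t * f x) ^+ (r.*2) * elem_sym (eigenvalues g s x) r <=
  elem_sym (eigenvalues g (radial t) x) r.
Proof.
move=> rm; have [i ix] := dom_cover x; have [j jx] := tdom_cover E x.
rewrite !(elem_sym_eigenvalues g _ rm ix jx) -muln2 mulnC exprM -sum_pminorsZ scalemxAl.
have [w ->] := radial_vertical_mx t i jx.
have -> : (1 + t * f x) ^+ 2 *: vertical_mx s i j x =
    ((1 + t * f x) *: nabla_mx s i j x) *m fibre_gram j x *m ((1 + t * f x) *: nabla_mx s i j x)^T.
  by rewrite linearZ /= -!scalemxAl -scalemxAr scalerA.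
exact: relative_pminors_mono rm (gram_posdef g ix) (fibre_gram_posdef jx).
Qed.

End RadialVariation.

Lemma elem_sym_bounded s r D : (r <= m)%N -> smooth_section s -> compact (closure D) ->
  exists c, forall x, D x -> 0 <= elem_sym (eigenvalues g s x) r <= c.
Proof.
move=> rm ss cD; pose f x := elem_sym (eigenvalues g s x) r.
have [Q [c cP] DQ] : exists2 Q : set M, (exists c, forall x, Q x -> f x <= c) & closure D `<=` Q.
  apply: (compact_subset_union (P := fun Q : set M => exists c, forall x, Q x -> f x <= c)) cD.
  - by exists 0.
  - move=> A B [c H] [c' H']; exists (Num.max c c') => x [/H|/H'] fx.
      by rewrite le_max fx.
    by rewrite le_max fx orbT.
  - move=> x _; exists [set y | f y < f x + 1]; last by exists (f x + 1) => y /ltW.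
    have cf : {for x, continuous f} by exact: elem_sym_continuous.
    have : \forall y \near x, f y < f x + 1; last by [].
    by apply: (cf [set z | z < f x + 1]); apply: lt_nbhsl; rewrite ltrDl.
exists c => x Dx; rewrite elem_sym_ge0 //=; apply: cP.
by apply: DQ; exact: subset_closure.
Qed.

(** Since r >= 1 and t f >= 0, the density grows at least by the factor 1 + t f. The gain t f eps_r
    is at least t c on U and nonnegative elsewhere. *)
Lemma radial_energy_ge s (f : M -> R) r D (U : set M) (c t : R) : smooth_section s -> constant_length s ->
  smoothM setT f -> (forall x, 0 <= f x) -> (0 < r <= m)%N ->
  open D -> compact (closure D) -> open U -> U `<=` D -> 0 <= c -> 0 <= t ->
  (forall x, U x -> c <= f x * elem_sym (eigenvalues g s x) r) ->
  vertical_energy mu r s D + t * (2^-1 * (c * fine (mu U))) <=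
  vertical_energy mu r (radial s f t) D.
Proof.
move=> ss sc sf f0 /andP[r0 rm] oD cD oU UD c0 t0 Uc.
have mU := open_measurable_borel oU; have mD := open_measurable_borel oD.
have [c1 b1] := elem_sym_bounded rm ss cD.
have [c2 b2] := elem_sym_bounded rm (radial_smooth ss sf t) cD.
have [fin1 _ _] := Rintegral_bound oD cD b1.
have [fin2 _ _] := Rintegral_bound oD cD b2.
have Uf : (mu U < +oo)%E.
  by apply: le_lt_trans (vol_compact mu oD cD); apply: le_measure; rewrite ?inE.
have finU : mu U \is a fin_num by rewrite ge0_fin_numE.
set I1 := integral mu _ _ in fin1; set I2 := integral mu _ _ in fin2.
suff key : (I1 + (t * c)%:E * mu U <= I2)%E.
  exact: fine_leD fin1 finU fin2 key.
apply: ge0_integral_superadditive => //; first exact: mulr_ge0.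
  by move=> x Dx; rewrite lee_fin elem_sym_ge0.
move=> x Dx; rewrite -EFinD lee_fin.
have e0 : 0 <= elem_sym (eigenvalues g s x) r by exact: elem_sym_ge0.
apply: le_trans (radial_elem_sym_le ss sc sf t x rm).
have tf0 : 0 <= t * f x by exact: mulr_ge0.
apply: (@le_trans _ _ ((1 + t * f x) * elem_sym (eigenvalues g s x) r)); last first.
  by rewrite ler_wpM2r // ler_eXnr ?double_gt0 // lerDl.
rewrite mulrDl mul1r lerD2l -!mulrA ler_wpM2l // indicE.
case: (boolP (x \in U)) => [/set_mem/Uc|_]; first by rewrite mulr1.
by rewrite mulr0 mulr_ge0.
Qed.

Lemma harmonic_parallel r s : smooth_section s -> constant_length s -> (0 < r <= m)%N ->
  r_harmonic mu r s -> r_parallel r s.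
Proof.
move=> ss sc rm har x0; have /andP[r0 rm'] := rm.
rewrite ltnNge; apply/negP => rk.
pose eps x := elem_sym (eigenvalues g s x) r.
have ep0 : 0 < eps x0.
  by rewrite lt0r elem_sym_eq0 // ltnNge rk /= elem_sym_ge0.
have open_gt_fun (h : M -> R) (a : R) : smoothM setT h -> open [set y | a < h y].
  move=> sh; apply: (open_comp (f := h) (D := [set z | a < z])); last exact: open_gt.
  by move=> y _; exact: (smoothM_continuous openT sh).
have [W [oW Wx] We] : exists2 W : set M, open W /\ W x0 & forall y, W y -> eps x0 / 2 < eps y.
  have : \forall y \near x0, eps x0 / 2 < eps y.
    have cf : {for x0, continuous eps} by exact: elem_sym_continuous.
    apply: (cf [set z | eps x0 / 2 < z]).
    apply: open_nbhs_nbhs; split; first exact: open_gt.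
    by rewrite /= ltr_pdivrMr // ltr_pMr // ltr1n.
  by rewrite /prop_near1 nbhsE => -[W ? h]; exists W.
(* A relatively compact domain is needed: D is the set where a bump function at x0 is positive, so
   its closure lies in the compact K1. *)
have [b [K1 [sb b0 bx cK1 [_ bK1]]]] := smoothM_bump openT (I : setT x0).
pose D := [set y | 0 < b y].
have oD : open D by exact: open_gt_fun.
have cD : compact (closure D).
  have clK : closed K1 by apply: compact_closed cK1; exact: points_hausdorff.
  apply: subclosed_compact cK1 _; first exact: closed_closure.
  rewrite [X in _ `<=` X](closure_id K1).1 //; apply: closure_subset => y Dy.
  by apply: contrapT => /bK1 e; rewrite /D /= e ltxx in Dy.
have oDW : open (D `&` W) by exact: openI.
(* The support of f lies in a compact subset of D, which makes the radial variation admissible. *)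
have [f [K [sf f0 fx cK [KDW fK]]]] := smoothM_bump oDW (conj bx Wx).
pose V := [set y | f x0 / 2 < f y].
have oV : open V by exact: open_gt_fun.
have Vx : V x0 by rewrite /V /= ltr_pdivrMr // ltr_pMr // ltr1n.
(* On U both f and eps exceed half their values at x0. The constant c is the product of these
   halves, and positive volume of U makes the slope k positive. *)
have [U [oU Ux UDWV /andP[mU0 mUoo]]] := vol_nbhs mu (openI oDW oV) (conj (conj bx Wx) Vx).
pose c := f x0 / 2 * (eps x0 / 2).
have c0 : 0 < c by rewrite mulr_gt0 ?divr_gt0.
have Uc x : U x -> c <= f x * eps x.
  have f20 : 0 <= f x0 / 2 by rewrite divr_ge0 // ltW.
  have e20 : 0 <= eps x0 / 2 by rewrite divr_ge0 // ltW.
  by move=> /UDWV[[_ /We/ltW ex] /ltW fx']; exact: ler_pM f20 e20 fx' ex.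
have UD : U `<=` D by move=> y /UDWV[[]].
have var : variation s D (radial s f).
  by apply: (radial_variation ss sf cK) => // y /KDW[].
have := har D oD cD _ var; set En := fun t => _.
pose k := 2^-1 * (c * fine (mu U)).
have k0 : 0 < k by rewrite mulr_gt0 // mulr_gt0 // fine_gt0 // mU0.
have E0 : En 0 = vertical_energy mu r s D.
  congr (vertical_energy mu r _ D); apply: functional_extensionality_dep => x.
  by rewrite /radial mul0r addr0 scale1r.
have Et t : 0 <= t -> t * k <= En t - En 0.
  move=> t0; rewrite lerBrDl E0.
  exact: (radial_energy_ge ss sc sf f0 rm oD cD oU UD (ltW c0) t0 Uc).
exact: (linear_growth_not_stationary k0 Et).
Qed.

End Harmonic.

Theorem corollary4p14 (R : realType) (m : nat) (M : manifold R m)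
    (g : riemannian_metric M) (mu : riemannian_volume g)
    (n : nat) (E : riemannian_vector_bundle M n)
    (s : forall x : M, E x)
    (s_smooth : smooth_section s) (s_const : constant_length s) :
  (forall r : nat, (1 <= r <= m)%N -> (r_harmonic mu r s <-> r_parallel r s)) /\
  (forall r : nat, (1 <= r <= m)%N -> (n <= r)%N -> r_harmonic mu r s).
Proof.
split=> r rm; have /andP[r0 rm'] := rm.
  by split; [exact: harmonic_parallel|exact: parallel_harmonic].
by move=> nr; apply: parallel_harmonic => //; exact: parallel_ge_rank.
Qed.
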